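(* Let $U$ be a unitary operator on a Hilbert space $\mathcal{H}$ having finite spectrum $\{e^{2\pi \mathrm{i}\theta_1},\dots,e^{2\pi \mathrm{i}\theta_k}\}$, where $\theta_i\in\mathbb{R}\setminus\mathbb{Q}$ for $1\le i\le k$. Let $\mathbf{T}=(T_1,T_2)$ be a pair of $U$-doubly twisted isometries on $\mathcal{H}$. Assume that all the wandering subspaces in the Wold decomposition of $\mathbf{T}$ are finite dimensional. Then $$C^*(\mathbf{T})\cong\bigoplus_{i=1}^kC_{\theta_i},$$ where $C_{\theta_i}\in\Delta_{\theta_i}$ for all $1\le i\le k$.
   Context: All Hilbert spaces are separable. A pair of isometries $(T_1,T_2)$ on $\mathcal{H}$ is $U$-doubly twisted (written $\mathbf{T}\leadsto C^{0,2}_U$ in the paper) if $T_iU=UT_i$ for $i=1,2$ and $T_1^*T_2=U^*T_2T_1^*$. $C^*(\mathbf{T})$ is the $C^*$-algebra generated by $T_1,T_2$. The wandering subspaces are $\mathcal{W}_A=\bigcap_{i\in A}\ker T_i^*$ for nonempty $A\subseteq\{1,2\}$. For $\theta\in\mathbb{R}\setminus\mathbb{Q}$, $\Delta_\theta$ is the set of $C^*$-algebras, considered up to isomorphism, generated by a pair of isometries $(R_1,R_2)$ with $R_1^*R_2=e^{-2\pi \mathrm{i}\theta}R_2R_1^*$ and with finite-dimensional wandering subspaces. *)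

(* Defs.v *)
From HB Require Import structures.
From mathcomp Require Import all_boot all_order all_algebra.
From mathcomp Require Import all_classical all_reals all_analysis.
From mathcomp Require Import complex ring lra.
Set Implicit Arguments.
Unset Strict Implicit.
Unset Printing Implicit Defensive.
Import Order.TTheory GRing.Theory Num.Theory.
Import numFieldNormedType.Exports.
Local Open Scope classical_set_scope.
Local Open Scope ring_scope.

(* The norm of a normed R[i]-module has values in R[i]; rnorm is the same norm
   read in R. *)
Definition rnorm (R : realType) (V : normedModType R[i]) (x : V) : R :=
  complex.Re `|x|.

Section rnorm_theory.
Variables (R : realType) (V : normedModType R[i]).
Implicit Types (x y : V) (a : R[i]) (F : set_system V).

Lemma rnormE x : `|x| = (rnorm x)%:C%C.
Proof. by rewrite /rnorm RRe_real// ger0_real. Qed.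

Lemma rnorm_ge0 x : 0 <= rnorm x.
Proof. by rewrite -ler0c -rnormE. Qed.

Lemma rnormD x y : rnorm (x + y) <= rnorm x + rnorm y.
Proof. by rewrite -lecR rmorphD/= -!rnormE ler_normD. Qed.

Lemma rnormZ a x : rnorm (a *: x) = complex.Re `|a| * rnorm x.
Proof.
rewrite /rnorm normrZ; apply: complexI; rewrite rmorphM/=.
by rewrite !RRe_real// ger0_real// mulr_ge0.
Qed.

Lemma rnorm0 : rnorm (0 : V) = 0.
Proof. by rewrite /rnorm normr0. Qed.

Lemma rnormN x : rnorm (- x) = rnorm x.
Proof. by rewrite /rnorm normrN. Qed.

Lemma rnormB x y : rnorm (x - y) = rnorm (y - x).
Proof. by rewrite -rnormN opprB. Qed.

Lemma rnorm_eq0 x : rnorm x = 0 -> x = 0.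
Proof. by move=> h; apply/eqP; rewrite -normr_eq0 rnormE h. Qed.

Lemma complex_pos (e : R[i]) : 0 < e -> exists2 r : R, 0 < r & e = r%:C%C.
Proof.
move=> e0; exists (complex.Re e); last by rewrite RRe_real// gtr0_real.
by move: e0; rewrite ltcE /= => /andP[].
Qed.

Lemma cvg_rnormP F (l : V) : Filter F ->
  F --> l <-> forall e : R, 0 < e -> \forall x \near F, rnorm (l - x) <= e.
Proof.
move=> FF; split.
  move=> /cvgrPdist_le h e e0.
  have /h : (0 : R[i]) < e%:C%C by rewrite ltcR.
  by apply: filterS => x; rewrite rnormE lecR.
move=> h; apply/cvgrPdist_le => e /complex_pos[r r0 ->].
by apply: filterS (h r r0) => x; rewrite rnormE lecR.
Qed.

Lemma cauchy_rnormP F : ProperFilter F ->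
  cauchy F <-> forall e : R, 0 < e ->
    exists x, \forall y \near F, rnorm (x - y) <= e.
Proof.
move=> FF; split.
  move=> /cauchyP h e e0.
  have /h : (0 : R[i]) < e%:C%C by rewrite ltcR.
  move=> [x xe]; exists x; apply: filterS xe => y.
  by rewrite -ball_normE /= rnormE ltcR => /ltW.
move=> h; apply/cauchyP => e /complex_pos[r r0 ->].
have [|x xe] := h (r / 2); first by rewrite divr_gt0.
exists x; apply: filterS xe => y; rewrite -ball_normE /= rnormE ltcR => /le_lt_trans.
by apply; rewrite ltr_pdivrMr// ltr_pMr// ltr1n.
Qed.

End rnorm_theory.

HB.mixin Record CompleteNormedModule_isHilbert (R : realType) V
    & CompleteNormedModule R[i] V := {
  inner : V -> V -> R[i];
  inner_linearl : forall z a x y, inner (a *: x + y) z = a * inner x z + inner y z;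
  inner_conj : forall x y, inner y x = (inner x y)^*%C;
  inner_norm : forall x, inner x x = `|x| ^+ 2
}.

#[short(type="hilbertType")]
HB.structure Definition Hilbert (R : realType) :=
  {V of CompleteNormedModule R[i] V & CompleteNormedModule_isHilbert R V}.

HB.mixin Record CompleteNormedModule_isCstarAlgebra (R : realType) A
    & CompleteNormedModule R[i] A := {
  cmul : A -> A -> A;
  cstar : A -> A;
  cmulA : associative cmul;
  cmulDl : left_distributive cmul +%R;
  cmulDr : right_distributive cmul +%R;
  cmulZl : forall a x y, cmul (a *: x) y = a *: cmul x y;
  cmulZr : forall a x y, cmul x (a *: y) = a *: cmul x y;
  cstarK : involutive cstar;
  cstarD : {morph cstar : x y / x + y};
  cstarZ : forall a x, cstar (a *: x) = a^*%C *: cstar x;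
  cstarM : forall x y, cstar (cmul x y) = cmul (cstar y) (cstar x);
  cnormM : forall x y, `|cmul x y| <= `|x| * `|y|;
  cnorm_star : forall x, `|cmul (cstar x) x| = `|x| ^+ 2
}.

#[short(type="cstarType")]
HB.structure Definition CstarAlgebra (R : realType) :=
  {A of CompleteNormedModule R[i] A & CompleteNormedModule_isCstarAlgebra R A}.

Section hilbert_theory.
Variables (R : realType) (H : hilbertType R).
Implicit Types (x y z : H) (a : R[i]).

Lemma innerDl x y z : inner (x + y) z = inner x z + inner y z.
Proof. by rewrite -[x in LHS]scale1r inner_linearl mul1r. Qed.

Lemma inner0l z : inner (0 : H) z = 0.
Proof. by apply: (addIr (inner 0 z)); rewrite -innerDl !add0r. Qed.

Lemma innerZl a x z : inner (a *: x) z = a * inner x z.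
Proof. by rewrite -[a *: x]addr0 inner_linearl inner0l addr0. Qed.

Lemma innerNl x z : inner (- x) z = - inner x z.
Proof. by rewrite -scaleN1r innerZl mulN1r. Qed.

Lemma innerBl x y z : inner (x - y) z = inner x z - inner y z.
Proof. by rewrite innerDl innerNl. Qed.

Lemma innerDr x y z : inner x (y + z) = inner x y + inner x z.
Proof. by rewrite inner_conj innerDl rmorphD/= -!inner_conj. Qed.

Lemma innerZr a x z : inner x (a *: z) = a^*%C * inner x z.
Proof. by rewrite inner_conj innerZl rmorphM/= -!inner_conj. Qed.

Lemma innerNr x y : inner x (- y) = - inner x y.
Proof. by rewrite inner_conj innerNl rmorphN/= -inner_conj. Qed.

Lemma innerBr x y z : inner x (y - z) = inner x y - inner x z.
Proof. by rewrite innerDr innerNr. Qed.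

Lemma inner_inj x y : (forall z, inner z x = inner z y) -> x = y.
Proof.
move=> h; apply/eqP; rewrite -subr_eq0 -normr_eq0 -sqrf_eq0 -inner_norm.
by rewrite innerBr h subrr.
Qed.

Lemma cauchy_schwarz x y : `|inner x y| <= `|x| * `|y|.
Proof.
have [->|y0] := eqVneq y 0.
  by rewrite inner_conj inner0l rmorph0 !normr0 mulr0.
have yy0 : 0 < `|y| by rewrite normr_gt0.
rewrite -(@ler_pXn2r _ 2)// ?nnegrE ?mulr_ge0// exprMn -!inner_norm.
have yy : 0 < inner y y by rewrite inner_norm exprn_gt0.
rewrite -ler_pdivrMr// -subr_ge0.
pose t := inner x y / inner y y.
suff -> : inner x x - `|inner x y| ^+ 2 / inner y y = `|x - t *: y| ^+ 2.
  by rewrite exprn_ge0.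
have tq : t * inner y y = inner x y by rewrite /t mulfVK// gt_eqF.
rewrite -inner_norm innerBl !innerBr !innerZl !innerZr -/t (mulrCA t) tq (inner_conj x y).
by rewrite sqr_normc /t; ring.
Qed.

Lemma inner_bound x y : `|complex.Re (inner x y)| <= rnorm x * rnorm y.
Proof.
rewrite -lecR rmorphM/= -!rnormE.
exact: le_trans (normc_ge_Re _) (cauchy_schwarz _ _).
Qed.

Lemma rnormDsqr x y :
  rnorm (x + y) ^+ 2 = rnorm x ^+ 2 + 2 * complex.Re (inner x y) + rnorm y ^+ 2.
Proof.
apply: complexI; rewrite !rmorphD/= !rmorphXn/= -!rnormE -!inner_norm.
rewrite innerDl !innerDr (inner_conj x y) rmorphM/= rmorph_nat -addcJ; ring.
Qed.

Section riesz.
Variables (f : H -> R[i]) (M : R).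
Hypothesis f_linear : forall a x y, f (a *: x + y) = a * f x + f y.
Hypothesis f_bound : forall x, `|f x| <= M%:C%C * `|x|.

Let fD x y : f (x + y) = f x + f y.
Proof. by rewrite -[x in LHS]scale1r f_linear mul1r. Qed.

Let f0 : f 0 = 0.
Proof. by apply: (addIr (f 0)); rewrite -fD !add0r. Qed.

Let fZ a x : f (a *: x) = a * f x.
Proof. by rewrite -[a *: x]addr0 f_linear f0 addr0. Qed.

Let phi x : R := rnorm x ^+ 2 - 2 * complex.Re (f x).

Let phi_lb x : - M ^+ 2 <= phi x.
Proof.
rewrite /phi; have : complex.Re (f x) <= M * rnorm x.
  apply: le_trans (ler_norm _) _; rewrite -lecR rmorphM/= -rnormE.
  exact: le_trans (normc_ge_Re _) (f_bound _).
by have := sqr_ge0 (rnorm x - M); nra.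
Qed.

Let phis : set R := [set phi x | x in setT].

Let phis_inf : has_inf phis.
Proof. by split; [exists (phi 0), 0 | exists (- M ^+ 2) => _ [x _ <-]]. Qed.

Let m := inf phis.

Let m_le x : m <= phi x.
Proof. by apply: ge_inf; [case: phis_inf | exists x]. Qed.

Let phi_mid x y : rnorm (x - y) ^+ 2 <= 2 * (phi x - m) + 2 * (phi y - m).
Proof.
have := m_le ((2^-1)%:C%C *: (x + y)).
rewrite /phi rnormZ fZ fD.
have -> : complex.Re `|(2^-1 : R)%:C%C| = 2^-1.
  by rewrite ger0_norm// ler0c invr_ge0.
have -> : complex.Re ((2^-1 : R)%:C%C * (f x + f y)) =
  2^-1 * (complex.Re (f x) + complex.Re (f y)).
  by case: (f x) (f y) => [? ?] [? ?] /=; rewrite mul0r subr0.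
rewrite exprMn !rnormDsqr innerNr rnormN.
have -> : complex.Re (- inner x y) = - complex.Re (inner x y).
  by case: (inner x y).
by lra.
Qed.

Let F : set_system H := filter_from [set e : R | 0 < e]
  (fun e => [set x | phi x <= m + e]).

Let FF : ProperFilter F.
Proof.
apply: filter_from_proper; last first.
  move=> e /= e0; have [_ [x _ <-]] := inf_adherent e0 phis_inf.
  by move=> /ltW h; exists x.
apply: filter_from_filter; first by exists 1 => /=.
move=> d e /= d0 e0; exists (Num.min d e); first by rewrite /= lt_min d0.
by move=> x /= h; split; apply: le_trans h _; rewrite lerD2l ge_min lexx ?orbT.
Qed.

Let F_cauchy : cauchy F.
Proof.
apply/(cauchy_rnormP FF) => e e0.
pose d := (e / 2) ^+ 2.
have d0 : 0 < d by rewrite exprn_gt0// divr_gt0.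
have [_ [x _ <-]] := inf_adherent d0 phis_inf.
rewrite -/m => xd; exists x; exists d => // y /= yd.
rewrite -(@ler_pXn2r _ 2)// ?nnegrE ?rnorm_ge0//; last exact: ltW.
apply: le_trans (phi_mid x y) _.
by move: xd yd; rewrite /d; nra.
Qed.

Let riesz_eq (y : H) : F --> y -> forall h, f h = inner h y.
Proof.
move=> /(cvg_rnormP _ FF) Fy h.
have key (t : R[i]) : 0 <=
    2 * complex.Re (t * (inner h y - f h)) + rnorm (t *: h) ^+ 2.
  apply/ler_addgt0Pr => e e0.
  pose d := e / 2 / (2 * rnorm (t *: h) + 1).
  have n0 : 0 <= rnorm (t *: h) by exact: rnorm_ge0.
  have d0 : 0 < d by rewrite !divr_gt0// ltr_pwDr// mulr_ge0.
  have e2 : 0 < e / 2 by rewrite divr_gt0.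
  have [x [xy xe]] : exists x, rnorm (y - x) <= d /\ phi x <= m + e / 2.
    have xe : F [set x | phi x <= m + e / 2] by exists (e / 2).
    have [x []] := @filter_ex _ F FF _ (@filterI _ F FF _ _ (Fy _ d0) xe).
    by exists x.
  have dE : d * (2 * rnorm (t *: h) + 1) = e / 2.
    by rewrite /d mulfVK// gt_eqF// ltr_pwDr// mulr_ge0.
  have := m_le (x + t *: h).
  rewrite {1}/phi rnormDsqr fD.
  have := inner_bound (t *: h) (y - x); rewrite ler_norml => /andP[+ _].
  move: xe; rewrite /phi !fZ (inner_conj (t *: h)) innerBr innerZl.
  rewrite innerZl mulrBr.
  set a := rnorm _ in n0 dE *.
  move: (rnorm x) (rnorm (y - x)) xy => p q xy.
  case: (t * inner h y) => a1 b1; case: (t * f h) => a2 b2.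
  case: (f x) => a3 b3; case: (t * inner h x) => a4 b4 /=.
  by nra.
apply/eqP; rewrite eq_sym -subr_eq0; apply/eqP.
set g := inner h y - f h in key *.
pose c : R := (1 + rnorm h ^+ 2)^-1.
have c0 : 0 < c by rewrite invr_gt0 ltr_pwDl// sqr_ge0.
have := key (- (c%:C%C * g^*%C)).
rewrite mulNr -mulrA (mulrC _ g) -sqr_normc rnormZ normrN normrM normcJ.
rewrite (_ : `|c%:C%C| = c%:C%C); last by rewrite ger0_norm// ler0c ltW.
rewrite -[`|g|]RRe_real ?ger0_real//.
set r := complex.Re `|g|.
have -> : complex.Re (- (c%:C%C * r%:C%C ^+ 2)) = - (c * r ^+ 2).
  by rewrite expr2 /= !(mulr0, mul0r, subr0, addr0) expr2.
have -> : complex.Re (c%:C%C * r%:C%C) = c * r.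
  by rewrite /= mulr0 subr0.
move=> h0.
have ch : c * (1 + rnorm h ^+ 2) = 1.
  by rewrite mulVf// gt_eqF// ltr_pwDl// sqr_ge0.
have r0 : r ^+ 2 <= 0.
  have : 0 <= c * r ^+ 2 * (c * rnorm h ^+ 2 - 2) by move: h0 => /=; lra.
  have -> : c * rnorm h ^+ 2 - 2 = - (1 + c) by move: ch; lra.
  have := sqr_ge0 r.
  move=> r1; rewrite mulrN oppr_ge0 => h1.
  by move: (mulr_ge0 (ltW c0) r1); nra.
have : r ^+ 2 == 0 by rewrite eq_le r0 sqr_ge0.
rewrite sqrf_eq0 => /eqP rE.
apply/eqP; rewrite -normr_eq0 -[`|g|]RRe_real ?ger0_real//.
by rewrite -/r rE.
Qed.

Lemma riesz_representation : exists y, forall x, f x = inner x y.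
Proof.
exists (lim F); apply: riesz_eq.
by have := @cauchy_cvg H F FF F_cauchy.
Qed.

End riesz.

End hilbert_theory.

Record bounded_op (R : realType) (H : hilbertType R) := BoundedOp {
  bop_fun :> H -> H;
  bop_linear : linear bop_fun;
  bop_bounded : exists M : R, forall x, rnorm (bop_fun x) <= M * rnorm x
}.

Section bounded_op_algebra.
Variables (R : realType) (H : hilbertType R).
Local Notation B := (bounded_op H).
Implicit Types (f g h : B) (x y : H) (a : R[i]).

HB.instance Definition _ := gen_eqMixin B.
HB.instance Definition _ := gen_choiceMixin B.
HB.instance Definition _ f :=
  GRing.isLinear.Build R[i] H H *:%R (bop_fun f) (@bop_linear R H f).

Lemma bop_ext f g : f =1 g -> f = g.
Proof.
case: f g => [f fl fb] [g gl gb] /= /funext fg.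
by subst g; congr BoundedOp; exact: Prop_irrelevance.
Qed.

Lemma bop_ge0_bound f :
  exists2 M : R, 0 <= M & forall x, rnorm (f x) <= M * rnorm x.
Proof.
have [M hM] := bop_bounded f; exists `|M| => // x.
by apply: le_trans (hM x) _; rewrite ler_wpM2r ?rnorm_ge0 ?ler_norm.
Qed.

Lemma bop0_subproof : linear (fun _ : H => 0 : H).
Proof. by move=> a x y; rewrite scaler0 addr0. Qed.

Lemma bop0_bounded : exists M : R, forall x : H, rnorm (0 : H) <= M * rnorm x.
Proof. by exists 0 => x; rewrite rnorm0 mul0r. Qed.

Definition bop0 : B := BoundedOp bop0_subproof bop0_bounded.

Lemma bop1_subproof : linear (@id H). Proof. by []. Qed.

Lemma bop1_bounded : exists M : R, forall x : H, rnorm (id x) <= M * rnorm x.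
Proof. by exists 1 => x; rewrite mul1r. Qed.

Definition bop1 : B := BoundedOp bop1_subproof bop1_bounded.

Lemma bopD_subproof f g : linear (fun x => f x + g x).
Proof. by move=> a x y; rewrite !linearP scalerDr addrACA. Qed.

Lemma bopD_bounded f g :
  exists M : R, forall x : H, rnorm (f x + g x) <= M * rnorm x.
Proof.
have [M hM] := bop_bounded f; have [N hN] := bop_bounded g.
by exists (M + N) => x; rewrite mulrDl (le_trans (rnormD _ _))// lerD.
Qed.

Definition bopD f g : B := BoundedOp (bopD_subproof f g) (bopD_bounded f g).

Lemma bopZ_subproof a f : linear (fun x => a *: f x).
Proof. by move=> b x y; rewrite linearP scalerDr !scalerA mulrC. Qed.

Lemma bopZ_bounded a f :
  exists M : R, forall x : H, rnorm (a *: f x) <= M * rnorm x.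
Proof.
have [M hM] := bop_bounded f; exists (complex.Re `|a| * M) => x.
by rewrite rnormZ -mulrA ler_wpM2l ?(rnorm_ge0 (a : R[i]^o)).
Qed.

Definition bopZ a f : B := BoundedOp (bopZ_subproof a f) (bopZ_bounded a f).

Lemma bopM_subproof f g : linear (fun x => f (g x)).
Proof. by move=> a x y; rewrite !linearP. Qed.

Lemma bopM_bounded f g :
  exists M : R, forall x : H, rnorm (f (g x)) <= M * rnorm x.
Proof.
have [M M0 hM] := bop_ge0_bound f; have [N hN] := bop_bounded g.
exists (M * N) => x; rewrite -mulrA (le_trans (hM _))//.
by rewrite ler_wpM2l.
Qed.

Definition bopM f g : B := BoundedOp (bopM_subproof f g) (bopM_bounded f g).

Let bopDA : associative bopD.
Proof. by move=> f g h; apply: bop_ext => x /=; rewrite addrA. Qed.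

Let bopDC : commutative bopD.
Proof. by move=> f g; apply: bop_ext => x /=; rewrite addrC. Qed.

Let bop0D : left_id bop0 bopD.
Proof. by move=> f; apply: bop_ext => x /=; rewrite add0r. Qed.

Let bopND : left_inverse bop0 (bopZ (-1)) bopD.
Proof. by move=> f; apply: bop_ext => x /=; rewrite scaleN1r addNr. Qed.

HB.instance Definition _ := GRing.isZmodule.Build B bopDA bopDC bop0D bopND.

Let bopZA a b f : bopZ a (bopZ b f) = bopZ (a * b) f.
Proof. by apply: bop_ext => x /=; rewrite scalerA. Qed.

Let bop1Z : left_id 1 bopZ.
Proof. by move=> f; apply: bop_ext => x /=; rewrite scale1r. Qed.

Let bopZDr : right_distributive bopZ +%R.
Proof. by move=> a f g; apply: bop_ext => x /=; rewrite scalerDr. Qed.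

Let bopZDl f : {morph bopZ^~ f : a b / a + b}.
Proof. by move=> a b; apply: bop_ext => x /=; rewrite scalerDl. Qed.

HB.instance Definition _ :=
  GRing.Zmodule_isLmodule.Build R[i] B bopZA bop1Z bopZDr bopZDl.

Lemma bop0E x : (0 : B) x = 0. Proof. by []. Qed.

Lemma bopDE f g x : (f + g) x = f x + g x. Proof. by []. Qed.

Lemma bopNE f x : (- f) x = - f x.
Proof. by rewrite -[RHS]scaleN1r. Qed.

Lemma bopBE f g x : (f - g) x = f x - g x.
Proof. by rewrite bopDE bopNE. Qed.

Lemma bopZE a f x : (a *: f) x = a *: f x. Proof. by []. Qed.

Definition op_bounds f : set R :=
  [set M | 0 <= M /\ forall x, rnorm (f x) <= M * rnorm x].

Definition opnorm f : R := inf (op_bounds f).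

Lemma op_bounds_neq0 f : op_bounds f !=set0.
Proof. by have [M M0 hM] := bop_ge0_bound f; exists M. Qed.

Lemma opnorm_ge0 f : 0 <= opnorm f.
Proof. by apply: lb_le_inf => [|M []//]; exact: op_bounds_neq0. Qed.

Lemma opnorm_le f M :
  0 <= M -> (forall x, rnorm (f x) <= M * rnorm x) -> opnorm f <= M.
Proof. by move=> M0 hM; apply: ge_inf => //; exists 0 => N []. Qed.

Lemma opnormP f x : rnorm (f x) <= opnorm f * rnorm x.
Proof.
have [x0|x0] := eqVneq x 0; first by rewrite x0 linear0 !rnorm0 mulr0.
have nx : 0 < rnorm x.
  by rewrite lt_neqAle rnorm_ge0 andbT eq_sym; apply: contra_neq x0 => /rnorm_eq0.
rewrite -ler_pdivrMr//; apply: lb_le_inf => [|M [_ hM]].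
  exact: op_bounds_neq0.
by rewrite ler_pdivrMr.
Qed.

Let opnormD f g : (opnorm (f + g))%:C%C <= (opnorm f)%:C%C + (opnorm g)%:C%C.
Proof.
rewrite -rmorphD/= lecR; apply: opnorm_le; first by rewrite addr_ge0 ?opnorm_ge0.
move=> x; rewrite bopDE mulrDl (le_trans (rnormD _ _))// lerD//; exact: opnormP.
Qed.

Let opnormZ_le a f : opnorm (a *: f) <= complex.Re `|a| * opnorm f.
Proof.
have a0 : 0 <= complex.Re `|a| by exact: (rnorm_ge0 (a : R[i]^o)).
apply: opnorm_le; first by rewrite mulr_ge0 ?opnorm_ge0.
by move=> x; rewrite bopZE rnormZ -mulrA ler_wpM2l// opnormP.
Qed.

Let opnorm0_eq0 f : (opnorm f)%:C%C = 0 -> f = 0.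
Proof.
move=> /complexI f0; apply: bop_ext => x; apply: rnorm_eq0; apply: le_anti.
by rewrite rnorm_ge0 andbT -[leRHS](mul0r (rnorm x)) -f0 opnormP.
Qed.

Let opnormZ a f : (opnorm (a *: f))%:C%C = `|a| * (opnorm f)%:C%C.
Proof.
rewrite -[`|a|]RRe_real ?ger0_real// -rmorphM; congr (_%:C%C).
have [->|a0] := eqVneq a 0.
  rewrite normr0 mul0r; apply: le_anti; rewrite opnorm_ge0 andbT.
  apply: opnorm_le => // x.
  by rewrite bopZE scale0r rnorm0 mul0r.
apply: le_anti; rewrite opnormZ_le/=.
have := opnormZ_le a^-1 (a *: f).
rewrite scalerA mulVf// scale1r => /(ler_wpM2l (rnorm_ge0 (a : R[i]^o))).
rewrite mulrA (_ : _ * complex.Re `|a^-1| = 1) ?mul1r//.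
have <- := rnormZ a (a^-1 : R[i]^o).
by rewrite /rnorm (_ : a *: _ = 1) ?normr1//; exact: divff.
Qed.

HB.instance Definition _ := @Lmodule_isNormed.Build R[i] B
  (fun f => (opnorm f)%:C%C) opnormD opnormZ opnorm0_eq0.

Lemma rnorm_bop f : rnorm f = opnorm f. Proof. by []. Qed.

Let bop_complete (F : set_system B) : ProperFilter F -> cauchy F -> cvg F.
Proof.
move=> FF /(cauchy_rnormP FF) Fc.
have Fx x : cvg ((fun f : B => f x) @ F).
  apply: cauchy_cvg; apply/cauchy_rnormP => e e0.
  have d0 : 0 < e / (1 + rnorm x).
    by rewrite divr_gt0// ltr_pwDl// rnorm_ge0.
  have [f hf] := Fc _ d0; exists (f x).
  suff : F [set g : B | rnorm (f x - g x) <= e] by [].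
  apply: filterS hf => g hg /=; rewrite -bopBE (le_trans (opnormP _ _))//.
  apply: le_trans (ler_wpM2r (rnorm_ge0 x) hg) _.
  rewrite mulrAC ler_pdivrMr ?ler_pM2l ?lerDr//.
  by rewrite ltr_pwDl// rnorm_ge0.
pose l x := lim ((fun f : B => f x) @ F).
have lP x e : 0 < e -> F [set f | rnorm (l x - f x) <= e].
  by have /cvg_rnormP := Fx x; apply.
have l_unique x y : (forall e, 0 < e -> F [set f | rnorm (y - f x) <= e]) ->
    l x = y.
  move=> h; apply/eqP; rewrite -subr_eq0; apply/eqP/rnorm_eq0; apply: le_anti.
  rewrite rnorm_ge0 andbT; apply/ler_addgt0Pr => e e0; rewrite add0r.
  have e2 : 0 < e / 2 by rewrite divr_gt0.
  have [f [/= h1 h2]] :=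
    @filter_ex _ F FF _ (@filterI _ F FF _ _ (lP x _ e2) (h _ e2)).
  rewrite -(subrKA (f x)) (le_trans (rnormD _ _))// [leRHS]splitr lerD//.
  by rewrite rnormB.
have l_linear : linear l.
  move=> a x y; apply: l_unique => e e0.
  have na : 0 <= complex.Re `|a| by exact: (rnorm_ge0 (a : R[i]^o)).
  have d0 : 0 < e / (1 + complex.Re `|a|) by rewrite divr_gt0// ltr_pwDl.
  apply: filterS2 (lP x _ d0) (lP y _ d0) => f hx hy /=.
  rewrite linearP opprD addrACA -scalerBr (le_trans (rnormD _ _))// rnormZ.
  apply: le_trans (lerD (ler_wpM2l na hx) hy) _.
  rewrite -[X in _ + X]mul1r -mulrDl [X in X * _]addrC mulrC mulfVK//.
  by rewrite gt_eqF// ltr_pwDl.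
have l_near f e : 0 < e -> (\forall g \near F, rnorm (f - g) <= e) ->
    forall x, rnorm (l x - f x) <= e * rnorm x.
  move=> e0 hf x; apply/ler_addgt0Pr => d d0.
  have [g [/= h1 h2]] :=
    @filter_ex _ F FF _ (@filterI _ F FF _ _ (lP x _ d0) hf).
  rewrite -(subrKA (g x)) (le_trans (rnormD _ _))// addrC lerD//.
  rewrite rnormB -bopBE (le_trans (opnormP _ _))//.
  by rewrite ler_wpM2r ?rnorm_ge0.
have l_bounded : exists M : R, forall x, rnorm (l x) <= M * rnorm x.
  have [f hf] := Fc _ ltr01.
  exists (1 + opnorm f) => x; rewrite -[l x](subrK (f x)) mulrDl.
  by rewrite (le_trans (rnormD _ _))// lerD// ?opnormP// l_near.
apply/cvg_ex; exists (BoundedOp l_linear l_bounded).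
apply/(cvg_rnormP _ FF) => e e0.
have e2 : 0 < e / 2 by rewrite divr_gt0.
have [f hf] := Fc _ e2; apply: filterS (hf) => g hg.
rewrite -(subrKA f) (le_trans (rnormD _ _))// [leRHS]splitr lerD//.
by rewrite rnorm_bop; apply: opnorm_le; [exact: ltW | move=> x; rewrite bopBE l_near].
Qed.

HB.instance Definition _ := Uniform_isComplete.Build B bop_complete.

Lemma adjoint_exists f :
  exists g : B, forall x y, inner (f x) y = inner x (g y).
Proof.
have [M M0 hM] := bop_ge0_bound f.
have : forall y, exists z, forall x, inner (f x) y = inner x z.
  move=> y; apply: (@riesz_representation _ _ _ (M * rnorm y)).
    by move=> a u v; rewrite linearP innerDl innerZl.
  move=> x; apply: le_trans (cauchy_schwarz _ _) _.
  rewrite !rnormE -!rmorphM/= lecR mulrAC.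
  by rewrite ler_wpM2r ?rnorm_ge0.
move=> /choice[g fg].
have gl : linear g.
  move=> a x y; apply: inner_inj => z.
  by rewrite -fg !innerDr !innerZr !fg.
suff gb : exists N : R, forall x, rnorm (g x) <= N * rnorm x.
  by exists (BoundedOp gl gb) => x y; rewrite /= fg.
exists M => y; have [g0|g0] := eqVneq (g y) 0.
  by rewrite g0 rnorm0 mulr_ge0 ?rnorm_ge0.
have ng : 0 < rnorm (g y).
  by rewrite lt_neqAle rnorm_ge0 andbT eq_sym; apply: contra_neq g0 => /rnorm_eq0.
rewrite -(@ler_pM2l _ (rnorm (g y)))//.
rewrite -lecR !rmorphM/= -!rnormE -expr2 -inner_norm -fg.
apply: le_trans (real_ler_norm _) _.
  by rewrite fg inner_norm realX// realE normr_ge0.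
apply: le_trans (cauchy_schwarz _ _) _.
rewrite !rnormE -!rmorphM/= lecR mulrCA mulrA ler_wpM2r ?rnorm_ge0//.
Qed.

Definition adjoint f : B := projT1 (cid (adjoint_exists f)).

Lemma adjointP f x y : inner (f x) y = inner x (adjoint f y).
Proof. exact: (projT2 (cid (adjoint_exists f))). Qed.

Let bopMA : associative bopM.
Proof. by move=> f g h; apply: bop_ext. Qed.

Let bopMDl : left_distributive bopM +%R.
Proof. by move=> f g h; apply: bop_ext. Qed.

Let bopMDr : right_distributive bopM +%R.
Proof. by move=> f g h; apply: bop_ext => x /=; rewrite linearD. Qed.

Let bopMZl a f g : bopM (a *: f) g = a *: bopM f g.
Proof. exact: bop_ext. Qed.

Let bopMZr a f g : bopM f (a *: g) = a *: bopM f g.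
Proof. by apply: bop_ext => x /=; rewrite linearZ. Qed.

Lemma adjoint_unique f g :
  (forall x y, inner (f x) y = inner x (g y)) -> adjoint f = g.
Proof.
by move=> h; apply: bop_ext => y; apply: inner_inj => z; rewrite -adjointP.
Qed.

Let adjointK : involutive adjoint.
Proof.
move=> f; apply: adjoint_unique => x y.
by rewrite inner_conj -adjointP -inner_conj.
Qed.

Let adjointD : {morph adjoint : f g / f + g}.
Proof.
move=> f g; apply: adjoint_unique => x y.
by rewrite !bopDE innerDl innerDr !adjointP.
Qed.

Let adjointZ a f : adjoint (a *: f) = a^*%C *: adjoint f.
Proof.
apply: adjoint_unique => x y.
by rewrite !bopZE innerZl innerZr conjcK adjointP.
Qed.

Let adjointM f g : adjoint (bopM f g) = bopM (adjoint g) (adjoint f).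
Proof. by apply: adjoint_unique => x y /=; rewrite !adjointP. Qed.

Lemma opnormM f g : opnorm (bopM f g) <= opnorm f * opnorm g.
Proof.
apply: opnorm_le; first by rewrite mulr_ge0 ?opnorm_ge0.
move=> x /=; rewrite (le_trans (opnormP _ _))// -mulrA.
by rewrite ler_wpM2l ?opnorm_ge0 ?opnormP.
Qed.

Let bopM_norm f g : `|bopM f g| <= `|f| * `|g|.
Proof. by rewrite !rnormE -rmorphM/= lecR; exact: opnormM. Qed.

Let sq_le f : opnorm f ^+ 2 <= opnorm (bopM (adjoint f) f).
Proof.
set N := opnorm (bopM _ _).
have N0 : 0 <= N by exact: opnorm_ge0.
suff : opnorm f <= Num.sqrt N.
  by rewrite -{2}(sqr_sqrtr N0) ler_pXn2r// ?nnegrE ?opnorm_ge0 ?sqrtr_ge0.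
apply: opnorm_le => [|x]; first exact: sqrtr_ge0.
rewrite -(@ler_pXn2r _ 2)// ?nnegrE ?mulr_ge0 ?rnorm_ge0 ?sqrtr_ge0//.
rewrite exprMn sqr_sqrtr// -lecR !rmorphXn rmorphM/= -rnormE -inner_norm adjointP.
apply: le_trans (real_ler_norm _) _.
  by rewrite -adjointP inner_norm realX// realE normr_ge0.
apply: le_trans (cauchy_schwarz _ _) _.
rewrite !rnormE -!rmorphM/= lecR expr2 mulrC mulrA.
by rewrite ler_wpM2r ?rnorm_ge0//; exact: (opnormP (bopM (adjoint f) f)).
Qed.

Let adjoint_norm_le f : opnorm f <= opnorm (adjoint f).
Proof.
have [f0|f0] := eqVneq (opnorm f) 0; first by rewrite f0 opnorm_ge0.
have fp : 0 < opnorm f by rewrite lt_neqAle opnorm_ge0 eq_sym f0.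
by rewrite -(@ler_pM2r _ (opnorm f))// -expr2 (le_trans (sq_le f))// opnormM.
Qed.

Let bop_cstar f : `|bopM (adjoint f) f| = `|f| ^+ 2.
Proof.
rewrite !rnormE -rmorphXn/= !rnorm_bop; congr (_%:C%C); apply: le_anti.
rewrite sq_le andbT (le_trans (opnormM _ _))// expr2 ler_wpM2r ?opnorm_ge0//.
by have := adjoint_norm_le (adjoint f); rewrite adjointK.
Qed.

HB.instance Definition _ := CompleteNormedModule_isCstarAlgebra.Build R B
  bopMA bopMDl bopMDr bopMZl bopMZr adjointK adjointD adjointZ adjointM
  bopM_norm bop_cstar.

End bounded_op_algebra.

Section generated_subalgebra.
Variables (R : realType) (A : cstarType R).
Implicit Types (x y : A) (a : R[i]).

Definition is_subcstar (B : set A) : Prop :=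
  [/\ closed B,
      B 0 /\ (forall a x y, B x -> B y -> B (a *: x + y)),
      (forall x y, B x -> B y -> B (cmul x y)) &
      (forall x, B x -> B (cstar x))].

(* The C*-subalgebra generated by S: the smallest norm-closed *-subalgebra of A
   containing S (cstar_algebra below is its carrier type). *)
Definition cstar_gen (S : set A) : set A :=
  [set x | forall B, is_subcstar B -> S `<=` B -> B x].

Lemma cstar_gen_sub (S : set A) : is_subcstar (cstar_gen S).
Proof.
split=> [||x y Bx By B hB SB|x Bx B hB SB].
- have -> : cstar_gen S = \bigcap_(B in [set B | is_subcstar B /\ S `<=` B]) B.
    by apply/seteqP; split=> x hx B => [[hB SB]|hB SB]; apply: hx.
  by apply: closed_bigI => B [[]].
- split=> [B [_ []]//|a x y Bx By B hB SB].
  by have [_ [_ h] _ _] := hB; apply: h; [apply: Bx|apply: By].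
- by have [_ _ h _] := hB; apply: h; [apply: Bx|apply: By].
- by have [_ _ _ h] := hB; apply: h; apply: Bx.
Qed.

Variable S : set A.

Definition in_cstar_gen : pred A := fun x => `[< cstar_gen S x >].

Record cstar_algebra := CstarElt {
  cstar_val :> A;
  cstar_valP : in_cstar_gen cstar_val
}.

Local Notation G := cstar_algebra.

HB.instance Definition _ := [isSub for cstar_val].
HB.instance Definition _ := [Choice of G by <:].

Let in_gen x : cstar_gen S x -> in_cstar_gen x.
Proof. by move=> h; apply/asboolP. Qed.

Let val_gen (u : G) : cstar_gen S (cstar_val u).
Proof. exact/asboolP/(cstar_valP u). Qed.

Let genP := cstar_gen_sub S.

Fact in_cstar_gen_submod : submod_closed in_cstar_gen.
Proof.
have [_ [g0 gL] _ _] := genP.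
split=> [|a x y /asboolP gx /asboolP gy]; first exact: in_gen.
by apply: in_gen; apply: gL.
Qed.

HB.instance Definition _ :=
  GRing.isSubmodClosed.Build R[i] A in_cstar_gen in_cstar_gen_submod.
HB.instance Definition _ := [SubChoice_isSubLmodule of G by <:].

Let gen_normD (u v : G) : `|val (u + v)| <= `|val u| + `|val v|.
Proof. by rewrite raddfD ler_normD. Qed.

Let gen_normZ a (u : G) : `|val (a *: u)| = `|a| * `|val u|.
Proof. by rewrite linearZ normrZ. Qed.

Let gen_norm0_eq0 (u : G) : `|val u| = 0 -> u = 0.
Proof. by move=> /normr0_eq0 u0; apply: val_inj; rewrite u0 raddf0. Qed.

HB.instance Definition _ := @Lmodule_isNormed.Build R[i] G
  (fun u => `|val u|) gen_normD gen_normZ gen_norm0_eq0.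

Lemma cstar_val_norm (u : G) : `|u| = `|val u|. Proof. by []. Qed.

Let gen_complete (F : set_system G) : ProperFilter F -> cauchy F -> cvg F.
Proof.
move=> FF /(cauchy_rnormP FF) Fc.
have VV : ProperFilter (cstar_val @ F) by exact: fmap_proper_filter.
have : cvg (cstar_val @ F).
  apply: cauchy_cvg; apply/cauchy_rnormP => e e0.
  have [u hu] := Fc _ e0; exists (val u).
  suff : F [set v : G | rnorm (val u - val v) <= e] by [].
  by apply: filterS hu => v /=; rewrite {1}/rnorm cstar_val_norm raddfB.
move=> /cvg_ex[l Fl].
have gl : cstar_gen S l.
  have [gc _ _ _] := genP.
  have Fg : F [set u : G | cstar_gen S (cstar_val u)].
    by apply: filterS filterT => u _; exact: val_gen.
  exact: (@closed_cvg _ _ F FF cstar_val _ gc Fg l Fl).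
apply/cvg_ex; exists (CstarElt (in_gen gl)); apply/(cvg_rnormP _ FF) => e e0.
have /(cvg_rnormP _ VV) /(_ _ e0) h := Fl.
have : F [set v : G | rnorm (l - val v) <= e] by [].
by apply: filterS => v /=; rewrite /rnorm cstar_val_norm raddfB.
Qed.

HB.instance Definition _ := Uniform_isComplete.Build G gen_complete.

Let gmul_subproof (u v : G) : in_cstar_gen (cmul (val u) (val v)).
Proof. by apply: in_gen; have [_ _ h _] := genP; apply: h. Qed.

Let gstar_subproof (u : G) : in_cstar_gen (cstar (val u)).
Proof. by apply: in_gen; have [_ _ _ h] := genP; apply: h. Qed.

Definition gmul (u v : G) : G := CstarElt (gmul_subproof u v).
Definition gstar (u : G) : G := CstarElt (gstar_subproof u).

Let gmulA : associative gmul.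
Proof. by move=> u v w; apply: val_inj; rewrite /= cmulA. Qed.

Let gmulDl : left_distributive gmul +%R.
Proof. by move=> u v w; apply: val_inj; rewrite /= cmulDl. Qed.

Let gmulDr : right_distributive gmul +%R.
Proof. by move=> u v w; apply: val_inj; rewrite /= cmulDr. Qed.

Let gmulZl a u v : gmul (a *: u) v = a *: gmul u v.
Proof. by apply: val_inj; rewrite /= cmulZl. Qed.

Let gmulZr a u v : gmul u (a *: v) = a *: gmul u v.
Proof. by apply: val_inj; rewrite /= cmulZr. Qed.

Let gstarK : involutive gstar.
Proof. by move=> u; apply: val_inj; rewrite /= cstarK. Qed.

Let gstarD : {morph gstar : u v / u + v}.
Proof. by move=> u v; apply: val_inj; rewrite /= cstarD. Qed.

Let gstarZ a u : gstar (a *: u) = a^*%C *: gstar u.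
Proof. by apply: val_inj; rewrite /= cstarZ. Qed.

Let gstarM u v : gstar (gmul u v) = gmul (gstar v) (gstar u).
Proof. by apply: val_inj; rewrite /= cstarM. Qed.

Let gnormM u v : `|gmul u v| <= `|u| * `|v|.
Proof. by rewrite !cstar_val_norm cnormM. Qed.

Let gnorm_star u : `|gmul (gstar u) u| = `|u| ^+ 2.
Proof. by rewrite !cstar_val_norm cnorm_star. Qed.

HB.instance Definition _ := CompleteNormedModule_isCstarAlgebra.Build R G
  gmulA gmulDl gmulDr gmulZl gmulZr gstarK gstarD gstarZ gstarM gnormM gnorm_star.

End generated_subalgebra.

(* The direct sum of C*-algebras: all families, with pointwise operations and the
   sup norm. *)
Definition cstar_sum (R : realType) (I : finType) (A : I -> cstarType R) : Type :=
  forall i, A i.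

Section direct_sum.
Variables (R : realType) (I : finType) (A : I -> cstarType R).
Local Notation D := (cstar_sum A).
Implicit Types (u v w : D) (a : R[i]).

HB.instance Definition _ := gen_eqMixin D.
HB.instance Definition _ := gen_choiceMixin D.

Definition dsum0 : D := fun=> 0.
Definition dsumN u : D := fun i => - u i.
Definition dsumD u v : D := fun i => u i + v i.
Definition dsumZ a u : D := fun i => a *: u i.
Definition dsumM u v : D := fun i => cmul (u i) (v i).
Definition dsum_star u : D := fun i => cstar (u i).

Lemma dsum_ext u v : (forall i, u i = v i) -> u = v.
Proof. exact: functional_extensionality_dep. Qed.

Let dsumDA : associative dsumD.
Proof. by move=> u v w; apply: dsum_ext => i; exact: addrA. Qed.

Let dsumDC : commutative dsumD.
Proof. by move=> u v; apply: dsum_ext => i; exact: addrC. Qed.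

Let dsum0D : left_id dsum0 dsumD.
Proof. by move=> u; apply: dsum_ext => i; exact: add0r. Qed.

Let dsumND : left_inverse dsum0 dsumN dsumD.
Proof. by move=> u; apply: dsum_ext => i; exact: addNr. Qed.

HB.instance Definition _ := GRing.isZmodule.Build D dsumDA dsumDC dsum0D dsumND.

Let dsumZA a b u : dsumZ a (dsumZ b u) = dsumZ (a * b) u.
Proof. by apply: dsum_ext => i; exact: scalerA. Qed.

Let dsum1Z : left_id 1 dsumZ.
Proof. by move=> u; apply: dsum_ext => i; exact: scale1r. Qed.

Let dsumZDr : right_distributive dsumZ +%R.
Proof. by move=> a u v; apply: dsum_ext => i; exact: scalerDr. Qed.

Let dsumZDl u : {morph dsumZ^~ u : a b / a + b}.
Proof. by move=> a b; apply: dsum_ext => i; exact: scalerDl. Qed.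

HB.instance Definition _ :=
  GRing.Zmodule_isLmodule.Build R[i] D dsumZA dsum1Z dsumZDr dsumZDl.

Definition dsum_norm u : R := \big[Num.max/0]_i rnorm (u i).

Let dsum_norm_ub u i : rnorm (u i) <= dsum_norm u.
Proof. exact: le_bigmax. Qed.

Let dsum_norm_le u (M : R) :
  0 <= M -> (forall i, rnorm (u i) <= M) -> dsum_norm u <= M.
Proof. by move=> M0 h; apply: bigmax_le. Qed.

Let dsum_norm_ge0 u : 0 <= dsum_norm u.
Proof. exact: bigmax_ge_id. Qed.

Let dsum_normD u v :
  (dsum_norm (u + v))%:C%C <= (dsum_norm u)%:C%C + (dsum_norm v)%:C%C.
Proof.
rewrite -rmorphD/= lecR; apply: dsum_norm_le => [|i]; first exact: addr_ge0.
by rewrite (le_trans (rnormD _ _))// lerD.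
Qed.

Let dsum_normZ a u : (dsum_norm (a *: u))%:C%C = `|a| * (dsum_norm u)%:C%C.
Proof.
rewrite -[`|a|]RRe_real ?ger0_real// -rmorphM; congr (_%:C%C).
have a0 : 0 <= complex.Re `|a| by exact: (rnorm_ge0 (a : R[i]^o)).
have mulr_max : {morph *%R (complex.Re `|a|) : x y / Num.max x y}.
  by move=> x y; exact: maxr_pMr.
rewrite /dsum_norm (big_morph _ mulr_max (mulr0 _)).
by apply: eq_bigr => i _; rewrite -rnormZ.
Qed.

Let dsum_norm0_eq0 u : (dsum_norm u)%:C%C = 0 -> u = 0.
Proof.
move=> /complexI u0; apply: dsum_ext => i; apply: rnorm_eq0.
by apply: le_anti; rewrite rnorm_ge0 andbT -u0.
Qed.

HB.instance Definition _ := @Lmodule_isNormed.Build R[i] D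
  (fun u => (dsum_norm u)%:C%C) dsum_normD dsum_normZ dsum_norm0_eq0.

Lemma rnorm_dsum u : rnorm u = dsum_norm u. Proof. by []. Qed.

Let dsum_complete (F : set_system D) : ProperFilter F -> cauchy F -> cvg F.
Proof.
move=> FF /(cauchy_rnormP FF) Fc.
have Fi i : cvg ((fun u : D => u i) @ F).
  apply: cauchy_cvg; apply/cauchy_rnormP => e e0.
  have [u hu] := Fc _ e0; exists (u i).
  suff : F [set v : D | rnorm (u i - v i) <= e] by [].
  by apply: filterS hu => v /(le_trans (dsum_norm_ub _ i)).
pose l : D := fun i => lim ((fun u : D => u i) @ F).
apply/cvg_ex; exists l; apply/(cvg_rnormP _ FF) => e e0.
have : F [set u : D | forall i, rnorm (l i - u i) <= e].
  apply: filter_forall => i.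
  by have /cvg_rnormP /(_ _ e0) := Fi i.
apply: filterS => u hu; rewrite rnorm_dsum.
by apply: dsum_norm_le => [|i]; [exact: ltW | exact: hu].
Qed.

HB.instance Definition _ := Uniform_isComplete.Build D dsum_complete.

Let dsumMA : associative dsumM.
Proof. by move=> u v w; apply: dsum_ext => i; exact: cmulA. Qed.

Let dsumMDl : left_distributive dsumM +%R.
Proof. by move=> u v w; apply: dsum_ext => i; exact: cmulDl. Qed.

Let dsumMDr : right_distributive dsumM +%R.
Proof. by move=> u v w; apply: dsum_ext => i; exact: cmulDr. Qed.

Let dsumMZl a u v : dsumM (a *: u) v = a *: dsumM u v.
Proof. by apply: dsum_ext => i; exact: cmulZl. Qed.

Let dsumMZr a u v : dsumM u (a *: v) = a *: dsumM u v.
Proof. by apply: dsum_ext => i; exact: cmulZr. Qed.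

Let dsum_starK : involutive dsum_star.
Proof. by move=> u; apply: dsum_ext => i; exact: cstarK. Qed.

Let dsum_starD : {morph dsum_star : u v / u + v}.
Proof. by move=> u v; apply: dsum_ext => i; exact: cstarD. Qed.

Let dsum_starZ a u : dsum_star (a *: u) = a^*%C *: dsum_star u.
Proof. by apply: dsum_ext => i; exact: cstarZ. Qed.

Let dsum_starM u v : dsum_star (dsumM u v) = dsumM (dsum_star v) (dsum_star u).
Proof. by apply: dsum_ext => i; exact: cstarM. Qed.

Let dsum_normM u v : `|dsumM u v| <= `|u| * `|v|.
Proof.
rewrite !rnormE -rmorphM/= lecR rnorm_dsum.
apply: dsum_norm_le => [|i]; first by rewrite mulr_ge0 ?rnorm_ge0.
apply: (@le_trans _ _ (rnorm (u i) * rnorm (v i))); last first.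
  by rewrite ler_pM ?rnorm_ge0//; exact: dsum_norm_ub.
by rewrite -lecR rmorphM/= -!rnormE; exact: cnormM.
Qed.

Let dsum_norm_star u : `|dsumM (dsum_star u) u| = `|u| ^+ 2.
Proof.
have sq i : rnorm (cmul (cstar (u i)) (u i)) = rnorm (u i) ^+ 2.
  by apply: complexI; rewrite rmorphXn/= -!rnormE cnorm_star.
rewrite !rnormE -rmorphXn/= !rnorm_dsum; congr (_%:C%C); apply: le_anti.
apply/andP; split.
  apply: dsum_norm_le => [|i]; first exact: sqr_ge0.
  by rewrite /dsumM /dsum_star sq ler_pXn2r ?nnegrE ?rnorm_ge0.
set N := dsum_norm (dsumM _ _).
have N0 : 0 <= N by exact: dsum_norm_ge0.
suff : dsum_norm u <= Num.sqrt N.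
  by rewrite -{2}(sqr_sqrtr N0) ler_pXn2r// ?nnegrE ?dsum_norm_ge0 ?sqrtr_ge0.
apply: dsum_norm_le => [|i]; first exact: sqrtr_ge0.
rewrite -(@ler_pXn2r _ 2)// ?nnegrE ?rnorm_ge0 ?sqrtr_ge0//.
by rewrite sqr_sqrtr// -sq; exact: (dsum_norm_ub (dsumM (dsum_star u) u)).
Qed.

HB.instance Definition _ := CompleteNormedModule_isCstarAlgebra.Build R D
  dsumMA dsumMDl dsumMDr dsumMZl dsumMZr dsum_starK dsum_starD dsum_starZ
  dsum_starM dsum_normM dsum_norm_star.

End direct_sum.

Section definitions.
Variable R : realType.

Definition star_isomorphic (A B : cstarType R) : Prop :=
  exists f : {linear A -> B},
    [/\ bijective f,
        (forall x y, f (cmul x y) = cmul (f x) (f y)) &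
        (forall x, f (cstar x) = cstar (f x))].

(* e^{it} *)
Definition cis (t : R) : R[i] := (cos t +i* sin t)%C.

Definition separable (T : topologicalType) : Prop :=
  exists2 D : set T, countable D & dense D.

Section operators.
Variable H : hilbertType R.
Implicit Types (U V : bounded_op H) (T : 'I_2 -> bounded_op H).

Definition invertible_op V : Prop :=
  exists W : bounded_op H, cmul V W = bop1 H /\ cmul W V = bop1 H.

Definition spectrum V : set R[i] :=
  [set l | ~ invertible_op (V - l *: bop1 H)].

Definition unitary_op U : Prop :=
  cmul (cstar U) U = bop1 H /\ cmul U (cstar U) = bop1 H.

Definition isometry_op V : Prop := forall x, `|V x| = `|x|.

Definition finite_dim (W : set H) : Prop :=
  exists (n : nat) (v : 'I_n -> H), (forall i, W (v i)) /\
    forall x, W x -> exists c : 'I_n -> R[i], x = \sum_(i < n) c i *: v i.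

(* A pair (T_1, T_2) is encoded as T : 'I_2 -> bounded_op H, with
   T_1 = T ord0 and T_2 = T ord_max. *)
Definition wandering T (A : {set 'I_2}) : set H :=
  [set x | forall i, i \in A -> cstar (T i) x = 0].

Definition finite_dim_wandering T : Prop :=
  forall A : {set 'I_2}, A != finset.set0 -> finite_dim (wandering T A).

Definition doubly_twisted U T : Prop :=
  (forall i, cmul (T i) U = cmul U (T i)) /\
  cmul (cstar (T ord0)) (T ord_max) =
    cmul (cstar U) (cmul (T ord_max) (cstar (T ord0))).

End operators.

(* The Hilbert space is required to be nonzero, which excludes the zero algebra. *)
Definition Delta (theta : R) (C : cstarType R) : Prop :=
  exists (K : hilbertType R) (S : 'I_2 -> bounded_op K),
    [/\ separable K /\ (exists x : K, x != 0),
        (forall i, isometry_op (S i)),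
        cmul (cstar (S ord0)) (S ord_max) =
          cis (- (2 * pi * theta)) *: cmul (S ord_max) (cstar (S ord0)),
        finite_dim_wandering S &
        star_isomorphic C (cstar_algebra (range S))].

End definitions.

(* Main.v *)
Require Import Defs.
From HB Require Import structures.
From mathcomp Require Import all_boot all_order all_algebra.
From mathcomp Require Import all_classical all_reals all_analysis.
From mathcomp Require Import complex.
From mathcomp Require Import lra.
Set Implicit Arguments.
Unset Strict Implicit.
Unset Printing Implicit Defensive.
Import Order.TTheory GRing.Theory Num.Theory.
Import numFieldNormedType.Exports.
Local Open Scope classical_set_scope.
Local Open Scope ring_scope.

(** An operator U with U T_i = T_i U and T_1^* T_2 = U^* T_2 T_1^* belongs to
    the C*-algebra of T: since the T_i are isometries,
      T_2^* (T_1^* T_2) T_1 = T_2^* U^* T_2 T_1^* T_1 = U^*.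
    A unitary U with finite spectrum is diagonalizable: the space is the
    orthogonal direct sum of the eigenspaces of U, and the projections E_i onto
    them are polynomials in U. Hence every E_i lies in C*(T); it also commutes
    with T, so it is a central projection of C*(T), and cutting by the E_i
    splits C*(T) into the direct sum of the C*-algebras of the restrictions of
    T to the eigenspaces ([reduction_isomorphism]). On the i-th eigenspace U is
    the scalar e^{2 i pi theta_i}, so the restricted pair satisfies the scalar
    twisted relation, and its wandering subspaces are images under E_i of those
    of T.

    Diagonalizability rests on [unitary_annihilated]: if a nonempty list s of
    numbers of modulus 1 contains the spectrum of U, then p(U) = 0 for p the
    product of the X - z, z in s. Put P = p(U) and
    m = ||P||^2. As U is unitary, U^n P^* = c P for n the degree of p and some
    scalar c, so U^n (P^* P - m) = q(U) with q = c p^2 - m X^n. If m <> 0 then q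
    does not vanish on s, so q(U) is a product of invertible operators, which
    makes P^* P - m bounded below. But P^* P - ||P||^2 never is, because
    ||(P^* P - m) x||^2 <= m (m ||x||^2 - ||P x||^2) ([left_inverse_norm_gap]).
    Once p(U) = 0, a polynomial that vanishes at all the eigenvalues kills U, and
    Lagrange interpolation gives the E_i. *)

(** * Operators and adjoints *)

Section cstar_lemmas.
Variables (R : realType) (A : cstarType R).
Implicit Types x y z : A.

Lemma cstarN x : cstar (- x) = - cstar x.
Proof. by rewrite -scaleN1r cstarZ rmorphN rmorph1 scaleN1r. Qed.

Lemma cstarB x y : cstar (x - y) = cstar x - cstar y.
Proof. by rewrite cstarD cstarN. Qed.

Lemma cstar0 : cstar (0 : A) = 0.
Proof. by rewrite -{1}(subrr (0 : A)) cstarB subrr. Qed.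

Lemma cmul0l x : cmul 0 x = 0.
Proof. by apply: (addIr (cmul 0 x)); rewrite -cmulDl addr0 add0r. Qed.

Lemma cmul0r x : cmul x 0 = 0.
Proof. by apply: (addIr (cmul x 0)); rewrite -cmulDr addr0 add0r. Qed.

Lemma cmulBr x y z : cmul x (y - z) = cmul x y - cmul x z.
Proof. by rewrite cmulDr -scaleN1r cmulZr scaleN1r. Qed.

Lemma cmulBl x y z : cmul (x - y) z = cmul x z - cmul y z.
Proof. by rewrite cmulDl -scaleN1r cmulZl scaleN1r. Qed.

End cstar_lemmas.

Section operator_sums.
Variables (R : realType) (H : hilbertType R).
Implicit Types (f g : bounded_op H) (x : H).

Lemma bopME f g x : cmul f g x = f (g x). Proof. by []. Qed.

Lemma bop_sumE (I : Type) (r : seq I) (P : pred I) (F : I -> bounded_op H) x :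
  (\sum_(i <- r | P i) F i) x = \sum_(i <- r | P i) F i x.
Proof. exact: (big_morph (fun f : bounded_op H => f x)). Qed.

Lemma cstar_bopP f x y : inner (f x) y = inner x (cstar f y).
Proof. exact: adjointP. Qed.

Lemma cstar_unique f g :
  (forall x y, inner (f x) y = inner x (g y)) -> cstar f = g.
Proof. exact: adjoint_unique. Qed.

Lemma bop1M f : cmul (bop1 H) f = f. Proof. exact: bop_ext. Qed.

Lemma bopM1 f : cmul f (bop1 H) = f. Proof. exact: bop_ext. Qed.

Lemma cstar_bop1 : cstar (bop1 H) = bop1 H.
Proof. exact: cstar_unique. Qed.

End operator_sums.

(** * Spectral decomposition of a unitary with finite spectrum *)

Section norm_gap.
Variables (R : realType) (H : hilbertType R).

(** P^* P - ||P||^2 has no bounded left inverse, unless P = 0. *)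
Lemma left_inverse_norm_gap (P W : bounded_op H) (m : R) :
  m = opnorm P ^+ 2 ->
  cmul W (cmul (cstar P) P - m%:C%C *: bop1 H) = bop1 H -> P = 0.
Proof.
move=> mE WE; apply: contrapT => P0.
have nP : 0 < opnorm P.
  rewrite lt_neqAle opnorm_ge0 andbT eq_sym; apply/eqP => P00; apply: P0.
  by apply: rnorm_eq0; rewrite rnorm_bop.
have m0 : 0 < m by rewrite mE exprn_gt0.
pose w := opnorm W.
have nPs : opnorm (cstar P) = opnorm P.
  have le f : opnorm f <= opnorm (cstar f : bounded_op H).
    have [->|f0] := eqVneq (opnorm f) 0; first exact: opnorm_ge0.
    have fp : 0 < opnorm f by rewrite lt_neqAle opnorm_ge0 eq_sym f0.
    rewrite -(@ler_pM2r _ (opnorm f))//.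
    have := cnorm_star f; rewrite !rnormE -rmorphXn/= => /complexI.
    rewrite !rnorm_bop -expr2 => <-; exact: opnormM.
  by apply: le_anti; rewrite le andbT; have := le (cstar P); rewrite cstarK.
have gap x : rnorm (cmul (cstar P) P x - m%:C%C *: x) ^+ 2 <=
    m ^+ 2 * rnorm x ^+ 2 - m * rnorm (P x) ^+ 2.
  rewrite rnormDsqr innerNr innerZr rnormN rnormZ bopME.
  have PPx : complex.Re (inner (cstar P (P x)) x) = rnorm (P x) ^+ 2.
    rewrite inner_conj -cstar_bopP inner_norm rnormE.
    have -> : (rnorm (P x))%:C%C ^+ 2 = (rnorm (P x) ^+ 2)%:C%C by rewrite rmorphXn.
    by rewrite conjc_real.
  rewrite conjc_real.
  have -> : complex.Re (- (m%:C%C * inner (cstar P (P x)) x)) =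
     - (m * rnorm (P x) ^+ 2).
    by rewrite -PPx; case: (inner _ _) => a b /=; rewrite mul0r subr0.
  have -> : complex.Re `|m%:C%C| = m by rewrite ger0_norm// ler0c ltW.
  have := opnormP (cstar P) (P x); rewrite nPs.
  rewrite -(@ler_pXn2r _ 2) ?nnegrE ?mulr_ge0 ?rnorm_ge0 ?opnorm_ge0//.
  rewrite !exprMn -mE; lra.
have bb x : rnorm x ^+ 2 <= w ^+ 2 * (m ^+ 2 * rnorm x ^+ 2 - m * rnorm (P x) ^+ 2).
  apply: le_trans (ler_wpM2l (sqr_ge0 _) (gap x)).
  rewrite -exprMn ler_pXn2r ?nnegrE ?mulr_ge0 ?rnorm_ge0 ?opnorm_ge0//.
  have {1}-> : x = W (cmul (cstar P) P x - m%:C%C *: x).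
    by have /(congr1 (fun f : bounded_op H => f x)) := WE; rewrite bopME bopBE.
  exact: opnormP.
have [x x0] : exists x, P x <> 0.
  apply: contrapT => /forallNP h; apply: P0; apply: bop_ext => x.
  by apply: contrapT; exact: h.
have nx : 0 < rnorm x.
  rewrite lt_neqAle rnorm_ge0 andbT eq_sym; apply/eqP => /rnorm_eq0 xE.
  by apply: x0; rewrite xE linear0.
have w0 : 0 < w ^+ 2.
  rewrite lt_neqAle sqr_ge0 andbT eq_sym; apply/eqP => w0.
  by have := bb x; rewrite w0 mul0r leNgt exprn_gt0.
(* [bb] makes t a bound of ||P y||^2 / ||y||^2 that is smaller than ||P||^2. *)
pose t := m - (w ^+ 2 * m)^-1.
have wm : 0 < w ^+ 2 * m by rewrite mulr_gt0.
have Pt y : rnorm (P y) ^+ 2 <= t * rnorm y ^+ 2.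
  have tE : w ^+ 2 * m * t = w ^+ 2 * m * m - 1.
    by rewrite mulrBr mulfV ?gt_eqF.
  rewrite -(ler_pM2l wm) [leRHS]mulrA tE.
  by have := bb y; lra.
have t0 : 0 <= t.
  have := le_trans (sqr_ge0 _) (Pt x).
  by rewrite pmulr_lge0// exprn_gt0.
have : opnorm P <= Num.sqrt t.
  apply: opnorm_le => [|y]; first exact: sqrtr_ge0.
  rewrite -(@ler_pXn2r _ 2) ?nnegrE ?mulr_ge0 ?rnorm_ge0 ?sqrtr_ge0//.
  by rewrite exprMn sqr_sqrtr.
rewrite -(@ler_pXn2r _ 2) ?nnegrE ?opnorm_ge0 ?sqrtr_ge0// sqr_sqrtr// -mE /t.
by rewrite lerBrDr gerDl leNgt invr_gt0 wm.
Qed.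

End norm_gap.

Section polynomial_calculus.
Variables (R : realType) (H : hilbertType R) (U : bounded_op H).
Implicit Types (p q : {poly R[i]}) (x : H).

(** The value p(U) of a polynomial p at the operator U. *)
Definition peval p : bounded_op H :=
  \sum_(i < size p) p`_i *: iter i (cmul U) (bop1 H).

Lemma pevalE n p x : (size p <= n)%N ->
  peval p x = \sum_(i < n) p`_i *: iter i U x.
Proof.
have iterE i : iter i (cmul U) (bop1 H) x = iter i U x.
  by elim: i => //= i ->.
move=> pn; rewrite /peval bop_sumE.
rewrite (big_ord_widen n (fun i => (p`_i *: iter i (cmul U) (bop1 H)) x) pn).
rewrite big_mkcond; apply: eq_bigr => i _; rewrite bopZE iterE.
by case: ltnP => // /(nth_default 0) ->; rewrite scale0r.
Qed.

Lemma pevalD p q : peval (p + q) = peval p + peval q.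
Proof.
apply: bop_ext => x; rewrite bopDE.
pose n := maxn (size p) (size q).
rewrite !(@pevalE n) ?leq_maxl ?leq_maxr ?size_polyD// -big_split.
by apply: eq_bigr => i _; rewrite coefD scalerDl.
Qed.

Lemma pevalZ a p : peval (a *: p) = a *: peval p.
Proof.
apply: bop_ext => x; rewrite bopZE.
rewrite !(@pevalE (size p)) ?size_scale_leq// scaler_sumr.
by apply: eq_bigr => i _; rewrite coefZ scalerA.
Qed.

Lemma pevalB p q : peval (p - q) = peval p - peval q.
Proof. by rewrite pevalD -scaleN1r pevalZ scaleN1r. Qed.

Lemma peval0 : peval 0 = 0.
Proof. by rewrite /peval size_poly0 big_ord0. Qed.

Lemma peval_sum (I : Type) (r : seq I) (P : pred I) (F : I -> {poly R[i]}) :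
  peval (\sum_(i <- r | P i) F i) = \sum_(i <- r | P i) peval (F i).
Proof. exact: (big_morph _ pevalD peval0). Qed.

Lemma peval1 : peval 1 = bop1 H.
Proof.
by apply: bop_ext => x; rewrite (@pevalE 1) ?size_poly1// big_ord1 coef1 scale1r.
Qed.

Lemma pevalC a : peval a%:P = a *: bop1 H.
Proof. by rewrite -alg_polyC pevalZ peval1. Qed.

Lemma pevalMX p : peval (p * 'X) = cmul U (peval p).
Proof.
apply: bop_ext => x; rewrite bopME.
rewrite (@pevalE (size p).+1) ?(@pevalE (size p))//; last first.
  by rewrite (leq_trans (size_polyMleq _ _))// size_polyX addn2.
rewrite big_ord_recl coefMX scale0r add0r linear_sum.
by apply: eq_bigr => i _; rewrite linearZ/= coefMX.
Qed.

Lemma pevalM p q : peval (p * q) = cmul (peval p) (peval q).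
Proof.
elim/poly_ind: p => [|p c IHp].
  by rewrite mul0r peval0; apply: bop_ext.
rewrite mulrDl mulrAC !pevalD !pevalMX IHp mul_polyC pevalZ pevalC.
by apply: bop_ext.
Qed.

Lemma pevalX : peval 'X = U.
Proof. by rewrite -['X]mul1r pevalMX peval1; apply: bop_ext. Qed.

Lemma pevalXsubC a : peval ('X - a%:P) = U - a *: bop1 H.
Proof. by rewrite pevalB pevalX pevalC. Qed.

Lemma peval_comm p q : cmul (peval p) (peval q) = cmul (peval q) (peval p).
Proof. by rewrite -!pevalM mulrC. Qed.

Lemma peval_prod_left_inverse (s : seq R[i]) :
  (forall z, z \in s -> ~ spectrum U z) ->
  exists W, cmul W (peval (\prod_(z <- s) ('X - z%:P))) = bop1 H.
Proof.
elim: s => [_|z s IHs zs].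
  by exists (bop1 H); rewrite big_nil peval1; apply: bop_ext.
have [|W WE] := IHs; first by move=> w ws; apply: zs; rewrite inE ws orbT.
have /contrapT[V [_ VE]] := zs z (mem_head _ _).
exists (cmul W V); rewrite big_cons pevalM pevalXsubC.
by rewrite -cmulA (cmulA V) VE bop1M.
Qed.

Section annihilator.
Hypothesis U_unitary : unitary_op U.

(** Up to U^n, the adjoint of p(U) is a multiple of p(U): for z on the unit
    circle, U (U - z)^* = - z^* (U - z). *)
Lemma unitary_peval_cstar (s : seq R[i]) :
  (forall z, z \in s -> z * z^*%C = 1) ->
  let p := \prod_(z <- s) ('X - z%:P) in
  exists c, cmul (peval 'X^(size s)) (cstar (peval p)) = c *: peval p.
Proof.
have [_ UU] := U_unitary.
elim: s => [_|z s IHs zs] /=.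
  exists 1; rewrite big_nil expr0 peval1 cstar_bop1 scale1r.
  exact: bop_ext.
have [|c cE] := IHs; first by move=> w ws; apply: zs; rewrite inE ws orbT.
have z1 := zs z (mem_head _ _).
exists (- z^*%C * c); rewrite big_cons.
set p := \prod_(_ <- _) _ in cE *.
rewrite [_ * p]mulrC pevalM pevalXsubC cstarM.
have UzE : cmul U (cstar (U - z *: bop1 H)) = - z^*%C *: (U - z *: bop1 H).
  rewrite cstarB cstarZ cstar_bop1 cmulDr UU.
  apply: bop_ext => x.
  rewrite !(bopDE, bopBE, bopNE, bopZE, bopME) linearN linearZ/= scalerBr scalerA.
  by rewrite mulNr [_ * z]mulrC z1 !scaleNr scale1r opprK addrC.
rewrite exprS mulrC pevalM pevalX -cmulA (cmulA U) UzE cmulZl cmulZr.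
rewrite cmulA -pevalXsubC peval_comm -cmulA cE cmulZr scalerA.
by rewrite [in RHS]peval_comm.
Qed.

(** The list [s] may exceed the spectrum; it has to be nonempty for q to be
    nonzero. *)
Lemma unitary_annihilated (s : seq R[i]) :
  s != [::] -> (forall z, z \in s -> z * z^*%C = 1) ->
  (forall z, spectrum U z -> z \in s) ->
  peval (\prod_(z <- s) ('X - z%:P)) = 0.
Proof.
move=> s0 s1 Us; set p := \prod_(_ <- _) _; set P := peval p.
pose m := opnorm P ^+ 2; apply: contrapT => P0.
have mN0 : m != 0.
  rewrite expf_neq0//; apply/eqP => P00; apply: P0.
  by apply: rnorm_eq0; rewrite rnorm_bop.
have [c cE] := unitary_peval_cstar s1; rewrite -/p -/P in cE.
pose n := size s; pose q := c *: (p * p) - m%:C%C *: 'X^n.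
have qE : peval q = cmul (peval 'X^n) (cmul (cstar P) P - m%:C%C *: bop1 H).
  by rewrite /q pevalB !pevalZ pevalM -/P cmulBr cmulZr bopM1 cmulA cE cmulZl.
have qs z : z \in s -> q.[z] != 0.
  move=> zs; have pz : p.[z] = 0 by apply/rootP; rewrite root_prod_XsubC.
  rewrite hornerD hornerN !hornerZ hornerM hornerXn pz !mulr0 sub0r.
  rewrite oppr_eq0 mulf_eq0 negb_or expf_neq0 ?andbT.
    by apply: contra_neq mN0 => /complexI.
  apply/eqP => z0; have := s1 z zs.
  by rewrite z0 mul0r => /eqP; rewrite eq_sym oner_eq0.
have qN0 : q != 0.
  have [z zs] : exists z, z \in s.
    by move: s0; case: (s) => // z s' _; exists z; exact: mem_head.
  by apply: contraNneq (qs z zs) => ->; rewrite horner0.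
have [r rE] := closed_field_poly_normal q.
have [|W WE] := @peval_prod_left_inverse r.
  move=> z zr /Us zs; move/negP: (qs z zs); apply; apply/eqP.
  have /rootP rz : root (\prod_(z <- r) ('X - z%:P)) z by rewrite root_prod_XsubC.
  by rewrite rE hornerZ rz mulr0.
apply: P0; pose V := (lead_coef q)^-1 *: cmul W (peval 'X^n).
apply: (@left_inverse_norm_gap _ _ P V m) => //; rewrite /V.
have qr : peval q = lead_coef q *: peval (\prod_(z <- r) ('X - z%:P)).
  by rewrite [in LHS]rE pevalZ.
by rewrite cmulZl -cmulA -qE qr cmulZr WE scalerA mulVf ?scale1r ?lead_coef_eq0.
Qed.

End annihilator.
End polynomial_calculus.

Section spectral_resolution.
Variables (R : realType) (H : hilbertType R) (U : bounded_op H).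
Variables (k : nat) (lam : 'I_k -> R[i]).
Hypotheses (U_unitary : unitary_op U) (lam_inj : injective lam).
Hypothesis lam_unit : forall i, lam i * (lam i)^*%C = 1.
Hypothesis U_spectrum : spectrum U = range lam.
Implicit Types (p : {poly R[i]}) (i j : 'I_k).

Lemma peval_prod_spectrum0 : peval U (\prod_i ('X - (lam i)%:P)) = 0.
Proof.
case: (posnP k) => [k0|k_gt0].
  (* With an empty spectrum, s = [:: 1] forces U = 1, so 1 = 0 as operators. *)
  have none (i : 'I_k) : False by case: i => m; rewrite k0.
  have U0 z : ~ spectrum U z by rewrite U_spectrum => -[j _ _]; case: (none j).
  have := @unitary_annihilated _ _ _ U_unitary [:: 1] isT.
  rewrite big_seq1 pevalXsubC => U1.
  have /contrapT[W [+ _]] := U0 1.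
  rewrite U1 => [W1|z|z /U0//]; last by rewrite inE => /eqP ->; rewrite rmorph1 mulr1.
  rewrite big1 ?peval1 => [|i]; last by case: (none i).
  by rewrite -W1; apply: bop_ext.
have -> : \prod_i ('X - (lam i)%:P) = \prod_(z <- codom lam) ('X - z%:P).
  by rewrite /codom /image_mem big_map big_enum.
apply: unitary_annihilated => //.
- by rewrite -size_eq0 size_codom card_ord -lt0n.
- by move=> _ /codomP[i ->].
- by move=> z; rewrite U_spectrum => -[j _ <-]; exact: codom_f.
Qed.

Lemma peval_vanish p : (forall i, p.[lam i] = 0) -> peval U p = 0.
Proof.
move=> p0.
have [||q ->] := @uniq_roots_prod_XsubC _ p (codom lam).
- by apply/allP => _ /codomP[i ->]; rewrite /root p0.
- by rewrite uniq_rootsE; apply/injectiveP.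
rewrite pevalM /codom /image_mem big_map big_enum peval_prod_spectrum0.
by apply: bop_ext => x; rewrite bopME !bop0E linear0.
Qed.

(** The Lagrange interpolation polynomial with value 1 at lam i and 0 at the
    other lam j. *)
Definition lagrange_poly i : {poly R[i]} :=
  (\prod_(j | j != i) (lam i - lam j))^-1 *: \prod_(j | j != i) ('X - (lam j)%:P).

Lemma lagrange_polyE i j : (lagrange_poly i).[lam j] = (i == j)%:R.
Proof.
rewrite hornerZ horner_prod; case: (eqVneq i j) => [<-|ij].
  rewrite [X in _ * X](eq_bigr (fun l => lam i - lam l)) => [|l _]; last first.
    by rewrite hornerXsubC.
  rewrite mulVf//; apply/prodf_neq0 => l li; rewrite subr_eq0.
  by apply: contra_neq li => /lam_inj.
rewrite [X in _ * X](_ : _ = 0) ?mulr0//; apply/eqP/prodf_eq0.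
by exists j; rewrite 1?eq_sym// hornerXsubC subrr.
Qed.

(** The spectral projection of U for the eigenvalue lam i. *)
Definition spectral_proj i : bounded_op H := peval U (lagrange_poly i).
Local Notation E := spectral_proj.

(* The evaluation rules of [hE] would otherwise unfold the interpolation
   polynomials. *)
Opaque lagrange_poly.

Let hE := (lagrange_polyE, hornerD, hornerN, hornerZ, hornerC, hornerM, hornerX).

Lemma spectral_proj_eigen i : cmul U (E i) = lam i *: E i.
Proof.
apply/eqP; rewrite -subr_eq0; apply/eqP.
have <- := @peval_vanish (('X - (lam i)%:P) * lagrange_poly i).
  by rewrite pevalM pevalXsubC cmulBl cmulZl bop1M.
move=> j; rewrite !hE; case: (eqVneq i j) => [->|_]; last by rewrite mulr0.
by rewrite subrr mul0r.
Qed.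

Lemma spectral_proj_idem i : cmul (E i) (E i) = E i.
Proof.
apply/eqP; rewrite -subr_eq0; apply/eqP.
have <- := @peval_vanish (lagrange_poly i * lagrange_poly i - lagrange_poly i).
  by rewrite pevalB pevalM.
by move=> j; rewrite !hE; case: (eqVneq i j) => _; rewrite ?mul1r ?mul0r subrr.
Qed.

Lemma spectral_proj_orthogonal i j : i != j -> cmul (E i) (E j) = 0.
Proof.
move=> ij; rewrite -pevalM peval_vanish// => l; rewrite !hE.
case: (eqVneq i l) => [<-|_]; last by rewrite mul0r.
by rewrite eq_sym (negbTE ij) mulr0.
Qed.

Lemma spectral_proj_sum : \sum_i E i = bop1 H.
Proof.
apply/eqP; rewrite -subr_eq0; apply/eqP.
rewrite -[RHS](@peval_vanish (\sum_i lagrange_poly i - 1)).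
  by rewrite pevalB peval_sum peval1.
move=> j; rewrite !hE horner_sum (bigD1 j)//= !hE eqxx big1 ?addr0 ?subrr//.
by move=> i /negbTE ij; rewrite !hE ij.
Qed.

(** Eigenspaces of a unitary for distinct eigenvalues are orthogonal, so
    E_j^* E_i = 0 for j <> i, and E_i = (sum_j E_j)^* E_i = E_i^* E_i. *)
Lemma spectral_proj_cstar i : cstar (E i) = E i.
Proof.
have orth j : i != j -> cmul (cstar (E j)) (E i) = 0.
  move=> ij; have [UU _] := U_unitary.
  have h : cmul (cstar (E j)) (E i) =
      ((lam j)^*%C * lam i) *: cmul (cstar (E j)) (E i).
    rewrite -scalerA -cmulZr -cmulZl -cstarZ -!spectral_proj_eigen cstarM.
    by rewrite -cmulA (cmulA (cstar U)) UU bop1M.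
  apply: contrapT => /eqP N0; move/negP: ij; apply; apply/eqP/lam_inj.
  have : (1 - (lam j)^*%C * lam i) *: cmul (cstar (E j)) (E i) = 0.
    by rewrite scalerBl scale1r -h subrr.
  move=> /eqP; rewrite scaler_eq0 (negbTE N0) orbF subr_eq0 => /eqP h1.
  by rewrite -[lam i]mul1r -(lam_unit j) -mulrA -h1 mulr1.
have h : E i = cmul (cstar (E i)) (E i).
  rewrite -[LHS]bop1M -cstar_bop1 -spectral_proj_sum (bigD1 i)//= cstarD cmulDl.
  rewrite [X in _ + X](_ : _ = 0) ?addr0//.
  rewrite (big_morph (@cstar R (bounded_op H)) (@cstarD _ _) (cstar0 _)).
  rewrite (big_morph (fun f => cmul f (E i)) (fun f g => cmulDl f g (E i)) (cmul0l _)).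
  by apply: big1 => j ji; rewrite orth// eq_sym.
by rewrite {1}h cstarM cstarK -h.
Qed.

(** If E_i = 0, then sum_(j <> i) (lam j - lam i)^-1 E_j inverts U - lam i, and
    lam i is not in the spectrum. *)
Lemma spectral_proj_neq0 i : E i <> 0.
Proof.
move=> Ei0; have : spectrum U (lam i) by rewrite U_spectrum; exists i.
apply; exists (peval U (\sum_(j | j != i) (lam j - lam i)^-1 *: lagrange_poly j)).
rewrite -pevalXsubC [X in _ /\ X = _]peval_comm -pevalM.
suff -> : peval U (('X - (lam i)%:P) *
    \sum_(j | j != i) (lam j - lam i)^-1 *: lagrange_poly j) = bop1 H by [].
rewrite -[RHS]subr0 -Ei0 -(peval1 U) -pevalB; apply/eqP.
rewrite -subr_eq0 -pevalB; apply/eqP/peval_vanish => j.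
rewrite !hE horner_sum; have [->|ji] := eqVneq j i.
  by rewrite !subrr mul0r subrr.
rewrite (bigD1 j)//= !hE eqxx mulr1 big1 => [|l /andP[_ /negbTE lj]]; last first.
  by rewrite !hE lj mulr0.
by rewrite addr0 subr0 divff ?subrr// subr_eq0 (inj_eq lam_inj).
Qed.

End spectral_resolution.

(** * Closed subspaces and compression of operators *)

Lemma rnorm_bounded_continuous (R : realType) (V W : normedModType R[i]) (f : V -> W)
    (M : R) :
  linear f -> (forall x, rnorm (f x) <= M * rnorm x) -> continuous f.
Proof.
move=> fl fM x; apply/cvg_rnormP => e e0.
have fB y z : f (y - z) = f y - f z.
  by rewrite addrC -scaleN1r fl scaleN1r addrC.
have d0 : 0 < e / (1 + `|M|) by rewrite divr_gt0// ltr_pwDl.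
have xd : nbhs x [set y | rnorm (x - y) <= e / (1 + `|M|)].
  by have /cvg_rnormP := @cvg_id _ (nbhs x); apply.
suff : nbhs x [set y | rnorm (f x - f y) <= e] by [].
apply: filterS xd => y /= xy; rewrite -fB (le_trans (fM _))//.
apply: (@le_trans _ _ ((1 + `|M|) * rnorm (x - y))).
  by rewrite ler_wpM2r ?rnorm_ge0// (le_trans (ler_norm _))// lerDr.
by rewrite mulrC -ler_pdivlMr// ltr_pwDl.
Qed.

Lemma closed_kernel (R : realType) (V W : normedModType R[i]) (f : V -> W) (M : R) :
  linear f -> (forall x, rnorm (f x) <= M * rnorm x) -> closed [set x | f x = 0].
Proof.
move=> fl fM; apply: (@preimage_closed _ _ f [set 0]).
  by move=> x _; exact: rnorm_bounded_continuous fl fM x.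
exact/accessible_closed_set1/hausdorff_accessible/norm_hausdorff.
Qed.

Section fixed_space.
Variables (R : realType) (H : hilbertType R) (E : bounded_op H).
Implicit Types a : R[i].

Definition in_fix : pred H := fun x => E x == x.

(** The fixed vectors of a bounded operator E form a closed subspace, a Hilbert
    space for the inner product of H. When E is a projection this is its range;
    the construction itself does not ask E to be one. *)
Record fixed_space := FixElt { fix_val :> H; fix_valP : in_fix fix_val }.

Local Notation K := fixed_space.

HB.instance Definition _ := [isSub for fix_val].
HB.instance Definition _ := [Choice of K by <:].

Lemma fixP (u : K) : E (val u) = val u.
Proof. exact/eqP/(fix_valP u). Qed.

Fact in_fix_submod : submod_closed in_fix.
Proof.
split=> [|a x y /eqP xE /eqP yE]; rewrite unfold_in; first by rewrite linear0.
by rewrite bop_linear xE yE.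
Qed.

HB.instance Definition _ := GRing.isSubmodClosed.Build R[i] H in_fix in_fix_submod.
HB.instance Definition _ := [SubChoice_isSubLmodule of K by <:].

Lemma fix_val_linear a (u v : K) : val (a *: u + v) = a *: val u + val v.
Proof. by []. Qed.

Let fix_normD (u v : K) : `|val (u + v)| <= `|val u| + `|val v|.
Proof. by rewrite raddfD ler_normD. Qed.

Let fix_normZ a (u : K) : `|val (a *: u)| = `|a| * `|val u|.
Proof. by rewrite linearZ normrZ. Qed.

Let fix_norm0_eq0 (u : K) : `|val u| = 0 -> u = 0.
Proof. by move=> /normr0_eq0 u0; apply: val_inj; rewrite u0 raddf0. Qed.

HB.instance Definition _ := @Lmodule_isNormed.Build R[i] K
  (fun u => `|val u|) fix_normD fix_normZ fix_norm0_eq0.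

Lemma fix_norm (u : K) : `|u| = `|val u|. Proof. by []. Qed.

Lemma fix_rnorm (u : K) : rnorm u = rnorm (val u). Proof. by []. Qed.

Lemma closed_fix : closed [set x | in_fix x].
Proof.
have -> : [set x | in_fix x] = [set x | (E - bop1 H) x = 0].
  apply/seteqP; split=> x; rewrite /mkset bopBE /in_fix.
    by move=> /eqP ->; exact: subrr.
  by move=> /eqP; rewrite subr_eq0.
apply: (@closed_kernel _ _ _ _ (opnorm (E - bop1 H))); first exact: bop_linear.
exact: opnormP.
Qed.

Let fix_complete (F : set_system K) : ProperFilter F -> cauchy F -> cvg F.
Proof.
move=> FF /(cauchy_rnormP FF) Fc.
have VV : ProperFilter (fix_val @ F) by exact: fmap_proper_filter.
have /cvg_ex[l Fl] : cvg (fix_val @ F).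
  apply: cauchy_cvg; apply/cauchy_rnormP => e /Fc[u hu]; exists (val u).
  suff : F [set v : K | rnorm (val u - val v) <= e] by [].
  by apply: filterS hu => v /=; rewrite fix_rnorm raddfB.
have lE : in_fix l.
  have Ff : F [set u : K | in_fix (fix_val u)].
    by apply: filterS filterT => u _; exact: fix_valP.
  exact: (@closed_cvg _ _ F FF fix_val _ closed_fix Ff l Fl).
apply/cvg_ex; exists (FixElt lE); apply/(cvg_rnormP _ FF) => e e0.
have /(cvg_rnormP _ VV) /(_ _ e0) h := Fl.
have : F [set v : K | rnorm (l - val v) <= e] by [].
by apply: filterS => v /=; rewrite fix_rnorm raddfB.
Qed.

HB.instance Definition _ := Uniform_isComplete.Build K fix_complete.

Let fix_inner (u v : K) : R[i] := inner (val u) (val v).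

Let fix_inner_linearl w a u v :
  fix_inner (a *: u + v) w = a * fix_inner u w + fix_inner v w.
Proof. by rewrite /fix_inner linearP inner_linearl. Qed.

Let fix_inner_conj u v : fix_inner v u = (fix_inner u v)^*%C.
Proof. exact: inner_conj. Qed.

Let fix_inner_norm u : fix_inner u u = `|u| ^+ 2.
Proof. exact: inner_norm. Qed.

HB.instance Definition _ := CompleteNormedModule_isHilbert.Build R K
  fix_inner_linearl fix_inner_conj fix_inner_norm.

Lemma fix_innerE (u v : K) : inner u v = inner (val u) (val v).
Proof. by []. Qed.

End fixed_space.

Section compression.
Variables (R : realType) (H : hilbertType R) (E : bounded_op H).
Hypotheses (E_idem : cmul E E = E) (E_star : cstar E = E).
Implicit Types (X Z : bounded_op H) (Y : bounded_op (fixed_space E)).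
Local Notation K := (fixed_space E).

Let in_fix_E x : in_fix E (E x).
Proof. by rewrite /in_fix -[E (E x)]/(cmul E E x) E_idem. Qed.

(** The idempotent E, seen as a map onto its range. *)
Definition fix_proj (x : H) : K := FixElt (in_fix_E x).

Lemma fix_projE x : val (fix_proj x) = E x. Proof. by []. Qed.

Lemma fix_projK : cancel val fix_proj.
Proof. by move=> u; apply: val_inj; rewrite fix_projE fixP. Qed.

Lemma fix_proj_linear : linear fix_proj.
Proof. by move=> a x y; apply: val_inj; rewrite fix_val_linear /= bop_linear. Qed.

Lemma fix_proj_bounded x : rnorm (fix_proj x) <= opnorm E * rnorm x.
Proof. by rewrite fix_rnorm opnormP. Qed.

Lemma fix_innerr (u : K) x : inner (val u) (E x) = inner (val u) x.
Proof.
have -> : E x = cstar E x by rewrite E_star.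
by rewrite -cstar_bopP fixP.
Qed.

Lemma compress_subproof X : linear (fun u : K => fix_proj (X (val u))).
Proof. by move=> a u v; rewrite fix_val_linear bop_linear fix_proj_linear. Qed.

Lemma compress_bound X (u : K) :
  rnorm (fix_proj (X (val u))) <= opnorm E * opnorm X * rnorm u.
Proof.
rewrite (le_trans (fix_proj_bounded _))// -mulrA ler_wpM2l ?opnorm_ge0//.
exact: opnormP.
Qed.

(** The compression of X to the range of E. *)
Definition compress X : bounded_op K :=
  BoundedOp (compress_subproof X) (ex_intro _ _ (compress_bound X)).

Lemma compressE X u : val (compress X u) = E (X (val u)). Proof. by []. Qed.

Lemma extend_subproof Y : linear (fun x => val (Y (fix_proj x))).
Proof. by move=> a x y; rewrite fix_proj_linear bop_linear fix_val_linear. Qed.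

Lemma extend_bound Y x :
  rnorm (val (Y (fix_proj x))) <= opnorm E * opnorm Y * rnorm x.
Proof.
rewrite -fix_rnorm (le_trans (opnormP _ _))// mulrAC mulrC.
by rewrite ler_wpM2r ?opnorm_ge0// fix_proj_bounded.
Qed.

(** The extension by 0 on the kernel of E of an operator on the range of E. *)
Definition extend Y : bounded_op H :=
  BoundedOp (extend_subproof Y) (ex_intro _ _ (extend_bound Y)).

Lemma extendE Y x : extend Y x = val (Y (fix_proj x)). Proof. by []. Qed.

Lemma compress_linear : linear compress.
Proof.
move=> a X Z; apply: bop_ext => u; apply: val_inj.
by rewrite bopDE bopZE fix_val_linear !compressE -bop_linear.
Qed.

Lemma extend_linear : linear extend.
Proof.
move=> a X Z; apply: bop_ext => u.
by rewrite bopDE bopZE !extendE bopDE bopZE fix_val_linear.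
Qed.

Lemma compress_bounded X : rnorm (compress X) <= opnorm E * rnorm X.
Proof.
rewrite !rnorm_bop; apply: opnorm_le; first by rewrite mulr_ge0 ?opnorm_ge0.
exact: compress_bound.
Qed.

Lemma extend_bounded Y : rnorm (extend Y) <= opnorm E * rnorm Y.
Proof.
rewrite !rnorm_bop; apply: opnorm_le; first by rewrite mulr_ge0 ?opnorm_ge0.
exact: extend_bound.
Qed.

Lemma compress_continuous : continuous compress.
Proof. exact: rnorm_bounded_continuous compress_linear compress_bounded. Qed.

Lemma extend_continuous : continuous extend.
Proof. exact: rnorm_bounded_continuous extend_linear extend_bounded. Qed.

Lemma compress_star X : compress (cstar X) = cstar (compress X).
Proof.
symmetry; apply: cstar_unique => u v; rewrite !fix_innerE !compressE.
by rewrite fix_innerr -cstar_bopP inner_conj fix_innerr -inner_conj.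
Qed.

Lemma extend_star Y : extend (cstar Y) = cstar (extend Y).
Proof.
symmetry; apply: cstar_unique => x y; rewrite !extendE.
have adj u z : inner (val (u : K)) z = inner u (fix_proj z).
  by rewrite fix_innerE fix_projE fix_innerr.
by rewrite adj inner_conj [RHS]inner_conj adj -inner_conj cstar_bopP -inner_conj.
Qed.

Lemma compressM X Z : cmul E Z = cmul Z E ->
  compress (cmul X Z) = cmul (compress X) (compress Z).
Proof.
move=> EZ; apply: bop_ext => u; apply: val_inj.
rewrite bopME !compressE bopME -[E (Z _)]/(cmul E Z (val u)) EZ.
by rewrite bopME fixP.
Qed.

(** No commutation is needed here, as [fix_proj] is a left inverse of the inclusion. *)
Lemma extendM Y1 Y2 : extend (cmul Y1 Y2) = cmul (extend Y1) (extend Y2).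
Proof. by apply: bop_ext => x; rewrite bopME !extendE bopME fix_projK. Qed.

Lemma extend_compress X : extend (compress X) = cmul E (cmul X E).
Proof. by apply: bop_ext => x; rewrite extendE compressE. Qed.

End compression.

(** * Splitting a generated C*-algebra along projections that it contains *)

Section generated_algebra.
Variables (R : realType) (H : hilbertType R) (S : set (bounded_op H)).
Local Notation G := (cstar_gen S).

Lemma cstar_genS x : S x -> G x.
Proof. by move=> Sx B _; apply. Qed.

Lemma cstar_genL a x y : G x -> G y -> G (a *: x + y).
Proof. by have [_ [_ h] _ _] := cstar_gen_sub S; exact: h. Qed.

Lemma cstar_gen0 : G 0.
Proof. by have [_ [h _] _ _] := cstar_gen_sub S. Qed.

Lemma cstar_genD x y : G x -> G y -> G (x + y).
Proof. by rewrite -{2}[x]scale1r; exact: cstar_genL. Qed.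

Lemma cstar_genZ a x : G x -> G (a *: x).
Proof.
by move=> Gx; rewrite -[a *: x]addr0; apply: cstar_genL; last exact: cstar_gen0.
Qed.

Lemma cstar_genM x y : G x -> G y -> G (cmul x y).
Proof. by have [_ _ h _] := cstar_gen_sub S; exact: h. Qed.

Lemma cstar_gen_star x : G x -> G (cstar x).
Proof. by have [_ _ _ h] := cstar_gen_sub S; exact: h. Qed.

Lemma cstar_gen_sum (I : Type) (r : seq I) (P : pred I) (F : I -> bounded_op H) :
  (forall i, P i -> G (F i)) -> G (\sum_(i <- r | P i) F i).
Proof. by move=> GF; apply: (big_ind G cstar_gen0 cstar_genD GF). Qed.

Lemma cstar_gen_peval U p : G (bop1 H) -> G U -> G (peval U p).
Proof.
move=> G1 GU; elim/poly_ind: p => [|p c IHp].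
  by rewrite peval0; exact: cstar_gen0.
rewrite pevalD pevalMX pevalC.
by apply: cstar_genD; [exact: cstar_genM | exact: cstar_genZ].
Qed.

(** The commutant of a self-adjoint E is a C*-algebra. *)
Lemma cstar_gen_commute E x : cstar E = E ->
  (forall y, S y -> cmul E y = cmul y E) -> G x -> cmul E x = cmul x E.
Proof.
move=> E_star SE Gx.
apply: (Gx [set y | cmul E y = cmul y E]) => //; split.
- have -> : [set y | cmul E y = cmul y E] = [set y | cmul E y - cmul y E = 0].
    apply/seteqP; split=> y; rewrite /mkset; first by move=> ->; rewrite subrr.
    by move=> /eqP; rewrite subr_eq0 => /eqP.
  apply: (@closed_kernel _ _ _ _ (opnorm E + opnorm E)) => [a y z|y].
    by rewrite cmulDr cmulDl cmulZr cmulZl opprD addrACA -scalerBr.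
  rewrite (le_trans (rnormD _ _))// rnormN mulrDl lerD//; first exact: opnormM.
  by rewrite mulrC; exact: opnormM.
- rewrite /mkset; split=> [|a y z yE zE]; first by rewrite cmul0l cmul0r.
  by rewrite cmulDr cmulDl cmulZr cmulZl yE zE.
- by move=> y z; rewrite /mkset => yE zE; rewrite cmulA yE -cmulA zE cmulA.
- move=> y; rewrite /mkset => yE.
  by rewrite -[in LHS]E_star -[in RHS]E_star -!cstarM yE.
Qed.

Lemma cstar_algebraP (X : cstar_algebra S) : G (val X).
Proof. exact/asboolP/(cstar_valP X). Qed.

End generated_algebra.

(** A family of operators T reduced by an orthogonal decomposition of the
    identity whose projections E_i lie in C*(T). *)
Section reduction.
Variables (R : realType) (H : hilbertType R) (I : finType) (J : Type).
Variables (E : I -> bounded_op H) (T : J -> bounded_op H).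
Hypotheses (E_idem : forall i, cmul (E i) (E i) = E i).
Hypotheses (E_star : forall i, cstar (E i) = E i).
Hypotheses (E_orth : forall i j, i != j -> cmul (E i) (E j) = 0).
Hypotheses (E_sum : \sum_i E i = bop1 H).
Hypotheses (T_comm : forall i j, cmul (E i) (T j) = cmul (T j) (E i)).
Hypotheses (E_gen : forall i, cstar_gen (range T) (E i)).
Local Notation comp i := (compress (E_idem i)).
Local Notation ext i := (extend (E_idem i)).
Local Notation summand i := (cstar_algebra (range (fun j => comp i (T j)))).

Lemma gen_commute i X : cstar_gen (range T) X -> cmul (E i) X = cmul X (E i).
Proof. by apply: cstar_gen_commute => // _ [j _ <-]. Qed.

Lemma gen_compress i X : cstar_gen (range T) X ->
  cstar_gen (range (fun j => comp i (T j))) (comp i X).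
Proof.
set G := cstar_gen (range (fun j => comp i (T j))) => GX.
(* Membership in C*(T) is carried along because compression is multiplicative
   only on operators that commute with E_i. *)
suff : cstar_gen (range T) X /\ G (comp i X) by case.
have [gc [g0 gL] gM gS] := cstar_gen_sub (range T).
have [Gc [G0 GL] GM GS] := cstar_gen_sub (range (fun j => comp i (T j))).
apply: (GX [set Y | cstar_gen (range T) Y /\ G (comp i Y)]).
  split.
  - apply: closedI => //; apply: preimage_closed => // Y _.
    exact: compress_continuous.
  - split=> [|a Y Z [gY GY] [gZ GZ]].
      by split=> //; rewrite (_ : comp i 0 = 0)//; apply: bop_ext => u;
        apply: val_inj; rewrite compressE linear0.
    by split; [exact: gL | rewrite compress_linear; exact: GL].
  - move=> Y Z [gY GY] [gZ GZ]; split; first exact: gM.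
    by rewrite compressM; [exact: GM | exact: gen_commute].
  - by move=> Y [gY GY]; split; [exact: gS | rewrite compress_star//; exact: GS].
move=> _ [j _ <-]; split; apply: cstar_genS; by exists j.
Qed.

Lemma gen_extend i Y :
  cstar_gen (range (fun j => comp i (T j))) Y -> cstar_gen (range T) (ext i Y).
Proof.
move=> GY; apply: (GY [set Z | cstar_gen (range T) (ext i Z)]).
  have [gc [g0 gL] gM gS] := cstar_gen_sub (range T).
  split.
  - by apply: preimage_closed => // Z _; exact: extend_continuous.
  - split=> [|a Z W gZ gW].
      by rewrite /mkset (_ : ext i 0 = 0)//; apply: bop_ext.
    by rewrite /mkset extend_linear; exact: gL.
  - by move=> Z W gZ gW; rewrite /mkset extendM; exact: gM.
  - by move=> Z gZ; rewrite /mkset extend_star//; exact: gS.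
move=> _ [j _ <-]; rewrite /mkset extend_compress.
by do 2?[apply: cstar_genM]; rewrite //; apply: cstar_genS; exists j.
Qed.

Let restrict_subproof (X : cstar_algebra (range T)) i :
  in_cstar_gen (range (fun j => comp i (T j))) (comp i (val X)).
Proof.
apply/asboolP; apply: gen_compress; exact: (cstar_algebraP X).
Qed.

(** An element of C*(T), as the family of its restrictions to the ranges of the
    E_i. *)
Definition restrict (X : cstar_algebra (range T)) : cstar_sum (fun i => summand i) :=
  fun i => CstarElt (restrict_subproof X i).

Let glue_subproof (u : cstar_sum (fun i => summand i)) :
  in_cstar_gen (range T) (\sum_i ext i (val (u i))).
Proof.
apply/asboolP; apply: cstar_gen_sum => i _; apply: gen_extend.
exact: (cstar_algebraP (u i)).
Qed.

(** The block diagonal operator with given blocks; it lies in C*(T) because the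
    E_i do. *)
Definition glue (u : cstar_sum (fun i => summand i)) : cstar_algebra (range T) :=
  CstarElt (glue_subproof u).

Lemma restrictK : cancel restrict glue.
Proof.
move=> X; apply: val_inj => /=.
rewrite (eq_bigr (fun i => cmul (val X) (E i))) => [|i _]; last first.
  rewrite extend_compress gen_commute; first by rewrite -cmulA E_idem.
  by apply: cstar_genM => //; exact: (cstar_algebraP X).
rewrite -(big_morph (cmul (val X)) (cmulDr _) (cmul0r _)) E_sum.
exact: bopM1.
Qed.

Lemma glueK : cancel glue restrict.
Proof.
move=> u; apply: dsum_ext => i; apply: val_inj; apply: bop_ext => x.
apply: val_inj; rewrite /= bop_sumE linear_sum (bigD1 i)//= big1 ?addr0.
  by rewrite -[RHS](fixP) /= -[in RHS](fix_projK (E_idem i) x).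
move=> j ji; rewrite -fixP -[LHS]/(cmul (E i) (E j) _) E_orth ?bop0E//.
by rewrite eq_sym.
Qed.

Lemma restrict_linear : linear restrict.
Proof.
by move=> a X Y; apply: dsum_ext => i; apply: val_inj; exact: compress_linear.
Qed.

Lemma reduction_isomorphism :
  star_isomorphic (cstar_algebra (range T)) (cstar_sum (fun i => summand i)).
Proof.
pose L := GRing.isLinear.Build R[i] _ _ *:%R restrict restrict_linear.
pose f : {linear cstar_algebra (range T) -> cstar_sum (fun i => summand i)} :=
  HB.pack restrict L.
exists f; split.
- by exists glue; [exact: restrictK | exact: glueK].
- move=> X Y; apply: dsum_ext => i; apply: val_inj; apply: compressM.
  by apply: gen_commute; exact: (cstar_algebraP Y).
- by move=> X; apply: dsum_ext => i; apply: val_inj; exact: compress_star.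
Qed.

End reduction.

(** * Doubly twisted isometries *)

Section isometries.
Variables (R : realType) (H : hilbertType R).
Implicit Types (V U : bounded_op H) (T : 'I_2 -> bounded_op H).

Lemma isometry_inner V x y : isometry_op V -> inner (V x) (V y) = inner x y.
Proof.
move=> VV; have Vn z : rnorm (V z) = rnorm z by rewrite /rnorm VV.
have VRe u v : complex.Re (inner (V u) (V v)) = complex.Re (inner u v).
  have := rnormDsqr (V u) (V v); rewrite -linearD !Vn rnormDsqr; lra.
(* The imaginary part of inner x y is the real part of inner (-i x) y. *)
have := VRe x y; have := VRe ('i%C *: x) y.
rewrite linearZ/= !innerZl.
case: (inner (V x) (V y)) => a b; case: (inner x y) => c d /=.
by rewrite !mul0r !mul1r !sub0r => /oppr_inj -> ->.
Qed.

Lemma isometry_cstar V : isometry_op V -> cmul (cstar V) V = bop1 H.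
Proof.
move=> VV; apply: bop_ext => x; apply: inner_inj => z.
by rewrite bopME -cstar_bopP isometry_inner.
Qed.

Lemma isometry_compress (E V : bounded_op H) (E_idem : cmul E E = E) :
  cmul E V = cmul V E -> isometry_op V -> isometry_op (compress E_idem V).
Proof.
move=> EV VV u; rewrite !fix_norm compressE -[E (V _)]/(cmul E V (val u)) EV.
by rewrite bopME fixP VV.
Qed.

(** U^* = T_2^* (T_1^* T_2) T_1. *)
Lemma twist_in_gen U T : unitary_op U -> (forall i, isometry_op (T i)) ->
  doubly_twisted U T -> cstar_gen (range T) U.
Proof.
move=> [UU _] TT [TU tw].
have <- : cstar (cmul (cstar (T ord_max))
    (cmul (cmul (cstar (T ord0)) (T ord_max)) (T ord0))) = U.
  rewrite tw -!cmulA isometry_cstar// bopM1 -[RHS]cstarK; congr cstar.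
  have UT : cmul (cstar (T ord_max)) (cstar U) = cmul (cstar U) (cstar (T ord_max)).
    by rewrite -!cstarM TU.
  by rewrite cmulA UT -cmulA isometry_cstar// bopM1.
have gT i : cstar_gen (range T) (T i) by apply: cstar_genS; exists i.
by do ?[apply: cstar_genM | apply: cstar_gen_star].
Qed.

Lemma id_in_gen T : (forall i, isometry_op (T i)) -> cstar_gen (range T) (bop1 H).
Proof.
move=> TT; rewrite -(isometry_cstar (TT ord0)).
have gT i : cstar_gen (range T) (T i) by apply: cstar_genS; exists i.
by apply: cstar_genM => //; exact: cstar_gen_star.
Qed.

Lemma peval_commute U V p : cmul V U = cmul U V ->
  cmul (peval U p) V = cmul V (peval U p).
Proof.
move=> VU; elim/poly_ind: p => [|p c IHp]; first by rewrite peval0 cmul0l cmul0r.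
rewrite pevalD pevalMX pevalC cmulDl cmulDr cmulZl cmulZr bop1M bopM1.
by rewrite -cmulA IHp !cmulA VU.
Qed.

Lemma separable_fixed_space (E : bounded_op H) : cmul E E = E ->
  separable H -> separable (fixed_space E).
Proof.
move=> E_idem [D cD dD]; exists (fix_proj E_idem @` D).
  exact: sub_countable (card_image_le _ _) cD.
move=> O [u Ou] oO.
have oP : open (fix_proj E_idem @^-1` O).
  apply: open_comp => // x _.
  exact: rnorm_bounded_continuous (fix_proj_linear E_idem) (fix_proj_bounded E_idem) x.
have [|x [Ox Dx]] := dD _ _ oP; first by exists (val u); rewrite /= fix_projK.
by exists (fix_proj E_idem x); split=> //; exists x.
Qed.

(** The images under E of vectors that span a wandering subspace of T span the
    corresponding wandering subspace of the compressed pair. *)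
Lemma finite_dim_wandering_compress (E : bounded_op H) T (E_idem : cmul E E = E) :
  cstar E = E -> (forall i, cmul E (T i) = cmul (T i) E) ->
  finite_dim_wandering T -> finite_dim_wandering (fun i => compress E_idem (T i)).
Proof.
move=> E_star ET fT A A0; have [n [v [Wv vT]]] := fT A A0.
have ETs i : cmul E (cstar (T i)) = cmul (cstar (T i)) E.
  by rewrite -[in LHS]E_star -[in RHS]E_star -!cstarM ET.
have cE i (u : fixed_space E) :
    val (cstar (compress E_idem (T i)) u) = cstar (T i) (val u).
  rewrite -compress_star// compressE -[LHS]/(cmul E (cstar (T i)) (val u)) ETs.
  by rewrite bopME fixP.
exists n, (fun l => fix_proj E_idem (v l)); split=> [l i iA|u Wu].
  apply: val_inj; rewrite cE fix_projE -[LHS]/(cmul (cstar (T i)) E (v l)) -ETs.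
  by rewrite bopME Wv// linear0.
have [|c uE] := vT (val u).
  by move=> i iA; rewrite -cE Wu.
exists c; apply: val_inj; rewrite -fixP uE linear_sum raddf_sum.
by apply: eq_bigr => l _; rewrite linearZ.
Qed.

End isometries.

Lemma cisN (R : realType) (t : R) : cis (- t) = (cis t)^*%C.
Proof. by rewrite /cis cosN sinN. Qed.

Lemma cis_unit (R : realType) (t : R) : cis t * (cis t)^*%C = 1.
Proof.
apply/eqP; rewrite eq_complex /= mulrN opprK -!expr2 cos2Dsin2 eqxx /=.
by rewrite mulrN mulrC addNr.
Qed.

Theorem theorem5p17 (R : realType) (H : hilbertType R) (U : bounded_op H)
    (k : nat) (theta : 'I_k -> R) (T : 'I_2 -> bounded_op H)
    (H_separable : separable H)
    (U_unitary : unitary_op U)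
    (theta_irrational : forall i, irrational (theta i))
    (theta_distinct : injective (fun i : 'I_k => cis (2 * pi * theta i)))
    (U_spectrum : spectrum U = range (fun i : 'I_k => cis (2 * pi * theta i)))
    (T_isometry : forall i, isometry_op (T i))
    (T_twisted : doubly_twisted U T)
    (T_wandering : finite_dim_wandering T) :
  exists C : 'I_k -> cstarType R,
    (forall i, Delta (theta i) (C i)) /\
    star_isomorphic (cstar_algebra (range T)) (cstar_sum C).
Proof.
pose lam i := cis (2 * pi * theta i).
have lam1 i : lam i * (lam i)^*%C = 1 by exact: cis_unit.
pose E := spectral_proj U lam.
have E_idem i : cmul (E i) (E i) = E i by exact: spectral_proj_idem.
have E_star i : cstar (E i) = E i by exact: spectral_proj_cstar.
have [TU tw] := T_twisted.
have ET i j : cmul (E i) (T j) = cmul (T j) (E i) by exact: peval_commute.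
have E_gen i : cstar_gen (range T) (E i).
  by apply: cstar_gen_peval; [exact: id_in_gen | exact: twist_in_gen].
exists (fun i => cstar_algebra (range (fun j => compress (E_idem i) (T j)))).
split=> [i|]; last first.
  apply: reduction_isomorphism => //.
  - by move=> i j; exact: spectral_proj_orthogonal.
  - exact: spectral_proj_sum.
have ETs j : cmul (E i) (cstar (T j)) = cmul (cstar (T j)) (E i).
  by rewrite -[in LHS]E_star -[in RHS]E_star -!cstarM ET.
exists (fixed_space (E i)), (fun j => compress (E_idem i) (T j)); split.
- split; first exact: separable_fixed_space.
  have [x Ex] : exists x, E i x <> 0.
    apply: contrapT => /forallNP E0.
    apply: (@spectral_proj_neq0 _ _ U _ lam U_unitary) (i) _ => //.
    by apply: bop_ext => x; apply: contrapT; exact: E0.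
  exists (fix_proj (E_idem i) x); apply/eqP => /(congr1 val).
  by rewrite fix_projE.
- by move=> j; exact: isometry_compress.
- rewrite cisN -/(lam i) -!compress_star// -!compressM// tw.
  have EU : cmul (E i) (cstar U) = (lam i)^*%C *: E i.
    by rewrite -[in LHS]E_star -cstarM spectral_proj_eigen// cstarZ E_star.
  apply: bop_ext => u; apply: val_inj.
  rewrite bopZE linearZ !compressE bopME.
  by rewrite -[LHS]/(cmul (E i) (cstar U) _) EU bopZE.
- exact: finite_dim_wandering_compress.
- by exists idfun; split=> //; exists id.
Qed.
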